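(* Let $(M,\varphi_i,\xi_i,\eta_i,g)$, $i=1,2,3$, be a $3$-$(\alpha,\delta)$-Sasaki manifold of dimension $4n+3$, $n\ge1$. The Ricci tensor of the canonical connection $\nabla$ is given by $$\mathrm{Ric}=4\alpha\{\delta(n+2)-3\alpha\}\,g+4\alpha\{\delta(2-n)-5\alpha\}\sum_{i=1}^3\eta_i\otimes\eta_i,$$ equivalently $\mathrm{Ric}=4\alpha\{\delta(n+2)-3\alpha\}\,\mathrm{Id}_{\mathcal H}+16\alpha(\delta-2\alpha)\,\mathrm{Id}_{\mathcal V}$. In particular, the manifold is $\nabla$-Einstein if and only if $\delta(2-n)=5\alpha$, and it is never $\nabla$-Ricci flat.
   Context: An almost contact metric structure $(\varphi,\xi,\eta,g)$ consists of a $(1,1)$-tensor field $\varphi$, a vector field $\xi$, a $1$-form $\eta$ and a Riemannian metric $g$ with $\varphi^2=-I+\eta\otimes\xi$, $\eta(\xi)=1$, $g(\varphi X,\varphi Y)=g(X,Y)-\eta(X)\eta(Y)$. Its fundamental form is $\Phi(X,Y)=g(X,\varphi Y)$. An almost $3$-contact metric manifold $(M,\varphi_i,\xi_i,\eta_i,g)$, $i=1,2,3$, is a manifold of dimension $4n+3$ with three almost contact metric structures with the same $g$ such that, for every even permutation $(i,j,k)$ of $(1,2,3)$, $\varphi_k=\varphi_i\varphi_j-\eta_j\otimes\xi_i=-\varphi_j\varphi_i+\eta_i\otimes\xi_j$, $\xi_k=\varphi_i\xi_j=-\varphi_j\xi_i$, $\eta_k=\eta_i\circ\varphi_j=-\eta_j\circ\varphi_i$.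 Set $\mathcal H=\bigcap_i\ker\eta_i$, $\mathcal V=\langle\xi_1,\xi_2,\xi_3\rangle$; $\mathrm{Id}_{\mathcal H}$, $\mathrm{Id}_{\mathcal V}$ stand for the restrictions of $g$ to $\mathcal H$, $\mathcal V$ (orthogonal projections, when $\mathrm{Ric}$ is viewed as an endomorphism). $M$ is $3$-$(\alpha,\delta)$-Sasaki if $d\eta_i=2\alpha\Phi_i+2(\alpha-\delta)\eta_j\wedge\eta_k$ for every even permutation $(i,j,k)$ of $(1,2,3)$, with real constants $\alpha\neq0$, $\delta$. A metric connection $\nabla$ has skew torsion if $g(T(X,Y),Z)$ is a $3$-form. The canonical connection of a $3$-$(\alpha,\delta)$-Sasaki manifold is the unique metric connection $\nabla$ with skew torsion such that $\nabla_X\varphi_i=\beta(\eta_k(X)\varphi_j-\eta_j(X)\varphi_k)$ for all vector fields $X$ and every even permutation $(i,j,k)$ of $(1,2,3)$, where $\beta=2(\delta-2\alpha)$ (it is known to exist). $\mathrm{Ric}$ is the Ricci tensor of $\nabla$, $\mathrm{Ric}(X,Y)=\sum_l g(R(e_l,X)Y,e_l)$ for a local orthonormal frame $(e_l)$, with $R(X,Y)=[\nabla_X,\nabla_Y]-\nabla_{[X,Y]}$. $M$ is $\nabla$-Einstein if (the symmetric part of) $\mathrm{Ric}$ is a multiple of $g$, and $\nabla$-Ricci flat if $\mathrm{Ric}=0$. Conventions: $d\eta(X,Y)=X(\eta(Y))-Y(\eta(X))-\eta([X,Y])$, $(\eta\wedge\zeta)(X,Y)=\eta(X)\zeta(Y)-\eta(Y)\zeta(X)$.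 *)

(* Defs.v *)
From HB Require Import structures.
From mathcomp Require Import all_boot all_order all_algebra all_fingroup.
From mathcomp Require Import all_classical all_reals all_analysis.
From mathcomp Require Import ring.
Set Implicit Arguments.
Unset Strict Implicit.
Unset Printing Implicit Defensive.
Import Order.TTheory GRing.Theory Num.Theory.
Import numFieldNormedType.Exports.
Local Open Scope classical_set_scope.
Local Open Scope ring_scope.

Section Smoothness.
Context {R : realType} {m : nat}.
Implicit Types (V : set 'rV[R]_m) (f h : 'rV[R]_m -> R).

Definition partial (i : 'I_m) f : 'rV[R]_m -> R := fun x => 'D_(delta_mx 0 i) f x.

(* On an open V, [Ck k V f] for every k is the usual C^oo condition: each
   partial derivative of order < k is differentiable at every point of V. *)
Fixpoint Ck (k : nat) V f : Prop :=
  if k is k'.+1 then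
    (forall x, V x -> differentiable f x) /\ (forall i, Ck k' V (partial i f))
  else forall x, V x -> {for x, continuous f}.

Definition smooth_on V f : Prop := forall k, Ck k V f.

Lemma near_eq_differentiable f h x :
  (\forall y \near x, f y = h y) -> differentiable f x -> differentiable h x.
Proof.
move=> fh fx; have -> : h = f + (h - f) by rewrite addrC subrK.
apply: differentiableD => //.
set u := h - f.
have u0 : \forall y \near x, u y = 0.
  by near=> y; rewrite /u /= !fctE -(near fh y)// subrr.
have ux : u x = 0 by apply: (nbhs_singleton u0).
have e : u \o shift x = cst (u x) + (\0 : {linear 'rV[R]_m -> R}) +o_ (0 : 'rV[R]_m) id.
  apply/eqaddoP => e e0.
  have : \forall y \near (0 : 'rV[R]_m), u (y + x) = 0.
    by move: u0; rewrite (near_shift 0 x) /=; apply: filterS => y; rewrite /= subr0.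
  apply: filterS => y uy.
  by rewrite !fctE /= uy ux addr0 subr0 normr0 mulr_ge0// ltW.
have c0 : continuous (\0 : {linear 'rV[R]_m -> R}) by apply: cst_continuous.
apply/diff_locallyP; rewrite (diff_unique c0 e); split => //.
Unshelve. all: by end_near. Qed.

Lemma Ck_eq k V f h : open V -> (forall x, V x -> f x = h x) ->
  Ck k V f -> Ck k V h.
Proof.
move=> oV; elim: k f h => [|k IH] f h fh /=.
  move=> fc x Vx; have nfh : \forall y \near x, f y = h y.
    by near=> y; apply: fh; near: y; exact: open_nbhs_nbhs.
  rewrite /prop_for /continuous_at -(nbhs_singleton nfh).
  exact: cvg_trans (near_eq_cvg nfh) (fc x Vx).
move=> [fd fk]; split=> [x Vx|i].
  apply: near_eq_differentiable (fd x Vx).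
  by near=> y; apply: fh; near: y; exact: open_nbhs_nbhs.
apply: IH (fk i) => x Vx; apply: near_eq_derive.
by near=> y; apply: fh; near: y; exact: open_nbhs_nbhs.
Unshelve. all: by end_near. Qed.

Lemma CkS k V f : Ck k.+1 V f -> Ck k V f.
Proof.
elim: k f => [|k IH] f [fd fk].
  by move=> x Vx; exact: differentiable_continuous (fd x Vx).
by split=> // i; apply: IH.
Qed.

Lemma Ck_cst k V c : Ck k V (cst c).
Proof.
elim: k c => [|k IH] c /=; first by move=> x _; exact: cst_continuous.
split=> [x _|i]; first exact: differentiable_cst.
suff -> : partial i (cst c) = cst 0 by exact: IH.
by apply/funext => x; rewrite /partial derive_cst.
Qed.

Lemma CkD k V f h : open V -> Ck k V f -> Ck k V h -> Ck k V (f + h).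
Proof.
move=> oV; elim: k f h => [|k IH] f h /=.
  by move=> fc hc x Vx; apply: continuousD; [exact: fc|exact: hc].
move=> [fd fk] [hd hk]; split=> [x Vx|i].
  by apply: differentiableD; [exact: fd|exact: hd].
apply: (Ck_eq oV _ (IH _ _ (fk i) (hk i))) => x Vx.
by rewrite /partial deriveD//; apply: diff_derivable; [exact: fd|exact: hd].
Qed.

Lemma CkM k V f h : open V -> Ck k V f -> Ck k V h -> Ck k V (f * h).
Proof.
move=> oV; elim: k f h => [|k IH] f h.
  by move=> fc hc x Vx; apply: continuousM; [exact: fc|exact: hc].
move=> fS hS; have [fd fk] := fS; have [hd hk] := hS; split=> [x Vx|i].
  by apply: differentiableM; [exact: fd|exact: hd].
apply: (Ck_eq oV _
  (CkD oV (IH _ _ (CkS fS) (hk i)) (IH _ _ (CkS hS) (fk i)))) => x Vx.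
by rewrite /partial deriveM//; apply: diff_derivable; [exact: fd|exact: hd].
Qed.

End Smoothness.

Record chart (R : realType) (m : nat) (M : topologicalType) := Chart {
  chart_dom : set M;
  chart_map : M -> 'rV[R]_m;
  chart_inv : 'rV[R]_m -> M;
  chart_img := chart_map @` chart_dom;
  chart_dom_open : open chart_dom;
  chart_img_open : open chart_img;
  chart_mapK : forall x, chart_dom x -> chart_inv (chart_map x) = x;
  chart_map_continuous : forall x, chart_dom x -> {for x, continuous chart_map};
  chart_inv_continuous : forall y, chart_img y -> {for y, continuous chart_inv}
}.

(* The atlas need not be maximal: every smooth atlas determines a unique
   smooth structure, hence the same smooth functions. *)
Record manifold (R : realType) (m : nat) := Manifold {
  points :> topologicalType;
  atlas : set (chart R m points);
  manifold_nonempty : [set: points] !=set0;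
  manifold_hausdorff : hausdorff_space points;
  manifold_second_countable : @second_countable points;
  atlas_cover : forall x : points, exists2 c, atlas c & chart_dom c x;
  atlas_compatible : forall c c', atlas c -> atlas c' -> forall i,
    smooth_on (chart_map c @` (chart_dom c `&` chart_dom c'))
      (fun y => chart_map c' (chart_inv c y) 0 i)
}.

Section SmoothFunctions.
Context {R : realType} {m : nat} (M : manifold R m).

Definition smooth (f : M -> R) : Prop :=
  forall c, atlas c -> smooth_on (chart_img c) (f \o chart_inv c).

Definition smooth_pred : {pred M -> R} := fun f => `[< smooth f >].

Record Cinf := SmoothFun {
  fun_of_Cinf :> M -> R;
  Cinf_smooth : fun_of_Cinf \in smooth_pred
}.

HB.instance Definition _ := [isSub for fun_of_Cinf].
HB.instance Definition _ := [Choice of Cinf by <:].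

Lemma smooth_subring_closed : subring_closed smooth_pred.
Proof.
have C c : (cst c : M -> R) \in smooth_pred.
  by apply/asboolP => d _ k; exact: Ck_cst.
have D f h : f \in smooth_pred -> h \in smooth_pred -> f + h \in smooth_pred.
  move=> /asboolP fs /asboolP hs; apply/asboolP => d dA k.
  by apply: CkD; [exact: chart_img_open|exact: fs|exact: hs].
have P f h : f \in smooth_pred -> h \in smooth_pred -> f * h \in smooth_pred.
  move=> /asboolP fs /asboolP hs; apply/asboolP => d dA k.
  by apply: CkM; [exact: chart_img_open|exact: fs|exact: hs].
split=> // [|f h fs hs]; first exact: C.
by apply: D => //; rewrite -mulN1r; apply: P => //; exact: (C (- 1)).
Qed.

Lemma smooth_scaler_closed : GRing.scaler_closed smooth_pred.
Proof.
move=> a f fs.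
have -> : a *: f = (cst a : M -> R) * f by apply/funext.
have [_ _ P] := smooth_subring_closed.
by apply: P => //; apply/asboolP => d _ k; exact: Ck_cst.
Qed.

HB.instance Definition _ :=
  GRing.SubChoice_isSubComPzRing.Build _ smooth_pred Cinf smooth_subring_closed.

Lemma smooth_subsemimod_closed : GRing.subsemimod_closed smooth_pred.
Proof.
split; last exact: smooth_scaler_closed.
have [_ sB _] := smooth_subring_closed.
have s0 : 0 \in smooth_pred by exact: (valP (0 : Cinf)).
split => // f h fs hs.
by rewrite -[h]opprK; apply: (sB) => //; rewrite -sub0r; exact: sB.
Qed.

HB.instance Definition _ :=
  GRing.SubZmodule_isSubLmodule.Build _ _ smooth_pred Cinf smooth_subsemimod_closed.

Lemma Cinf_eqP (f h : Cinf) : (forall p, f p = h p) <-> f = h.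
Proof. by split=> [e|-> //]; apply/val_inj/funext. Qed.

Lemma Cinf_oner_neq0 : (1 : Cinf) != 0.
Proof.
have [p _] := manifold_nonempty M; apply/eqP => /Cinf_eqP /(_ p) /eqP.
by rewrite /= (oner_eq0 R).
Qed.

HB.instance Definition _ := GRing.PzSemiRing_isNonZero.Build Cinf Cinf_oner_neq0.

Lemma Cinf_scalerAl (a : R) (f h : Cinf) : a *: (f * h) = (a *: f) * h.
Proof. by apply/Cinf_eqP => p; exact: mulrA. Qed.

HB.instance Definition _ := GRing.Lmodule_isLalgebra.Build R Cinf Cinf_scalerAl.
HB.instance Definition _ := GRing.Lalgebra_isComAlgebra.Build R Cinf.

End SmoothFunctions.

Section VectorFields.
Context {R : realType} {m : nat} (M : manifold R m).
Local Notation C := (Cinf M).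

(* Vector fields are R-linear derivations of C^oo(M). *)
Record vfield := VField {
  vf_fun :> C -> C;
  vf_linear : linear vf_fun;
  vf_leibniz : forall f h, vf_fun (f * h) = vf_fun f * h + f * vf_fun h
}.

HB.instance Definition _ := gen_eqMixin vfield.
HB.instance Definition _ := gen_choiceMixin vfield.

Implicit Types (X Y : vfield) (f h : C).

Lemma vfieldP X Y : (forall f, X f = Y f) -> X = Y.
Proof.
case: X Y => [X Xl XM] [Y Yl YM] /= /funext XY.
by case: _ / XY in Yl YM *; congr VField; exact: Prop_irrelevance.
Qed.

Lemma vfP X (a : R) f h : X (a *: f + h) = a *: X f + X h.
Proof. exact: vf_linear. Qed.

Lemma vfD X : {morph X : f h / f + h}.
Proof. by move=> f h; rewrite -[f in LHS]scale1r vfP scale1r. Qed.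

Lemma vf0 X : X 0 = 0.
Proof. by apply: (@addIr _ (X 0)); rewrite -vfD !add0r. Qed.

Lemma vfN X : {morph X : f / - f}.
Proof. by move=> f; apply: (@addIr _ (X f)); rewrite -vfD !addNr vf0. Qed.

Lemma vf_add_linear X Y : linear (fun f => X f + Y f).
Proof. by move=> a f h; rewrite !vfP scalerDr addrACA. Qed.
Lemma vf_add_leibniz X Y f h :
  X (f * h) + Y (f * h) = (X f + Y f) * h + f * (X h + Y h).
Proof. by rewrite !vf_leibniz mulrDl mulrDr addrACA. Qed.
Definition vf_add X Y := VField (vf_add_linear X Y) (vf_add_leibniz X Y).

Lemma vf_opp_linear X : linear (fun f => - X f).
Proof. by move=> a f h; rewrite vfP opprD scalerN. Qed.
Lemma vf_opp_leibniz X f h : - X (f * h) = (- X f) * h + f * (- X h).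
Proof. by rewrite vf_leibniz opprD mulNr mulrN. Qed.
Definition vf_opp X := VField (vf_opp_linear X) (vf_opp_leibniz X).

Lemma vf_zero_linear : linear (fun _ : C => 0 : C).
Proof. by move=> a f h; rewrite scaler0 addr0. Qed.
Lemma vf_zero_leibniz f h : 0 = 0 * h + f * 0 :> C.
Proof. by rewrite mul0r mulr0 addr0. Qed.
Definition vf_zero := VField vf_zero_linear vf_zero_leibniz.

Lemma vf_scale_linear u X : linear (fun f => u * X f).
Proof. by move=> a f h; rewrite vfP mulrDr scalerAr. Qed.
Lemma vf_scale_leibniz u X f h :
  u * X (f * h) = (u * X f) * h + f * (u * X h).
Proof. by rewrite vf_leibniz mulrDr mulrA [u * (f * _)]mulrCA. Qed.
Definition vf_scale u X := VField (vf_scale_linear u X) (vf_scale_leibniz u X).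

Lemma vf_addA : associative vf_add.
Proof. by move=> X Y Z; apply: vfieldP => f; exact: addrA. Qed.
Lemma vf_addC : commutative vf_add.
Proof. by move=> X Y; apply: vfieldP => f; exact: addrC. Qed.
Lemma vf_add0 : left_id vf_zero vf_add.
Proof. by move=> X; apply: vfieldP => f; exact: add0r. Qed.
Lemma vf_addN : left_inverse vf_zero vf_opp vf_add.
Proof. by move=> X; apply: vfieldP => f; exact: addNr. Qed.
HB.instance Definition _ :=
  GRing.isZmodule.Build vfield vf_addA vf_addC vf_add0 vf_addN.

Lemma vf_scaleA u v X : vf_scale u (vf_scale v X) = vf_scale (u * v) X.
Proof. by apply: vfieldP => f; exact: mulrA. Qed.
Lemma vf_scale1 : left_id 1 vf_scale.
Proof. by move=> X; apply: vfieldP => f; exact: mul1r. Qed.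
Lemma vf_scaleDr : right_distributive vf_scale +%R.
Proof. by move=> u X Y; apply: vfieldP => f; exact: mulrDr. Qed.
Lemma vf_scaleDl X : {morph vf_scale^~ X : u v / u + v}.
Proof. by move=> u v; apply: vfieldP => f; exact: mulrDl. Qed.
HB.instance Definition _ := GRing.Zmodule_isLmodule.Build C vfield
  vf_scaleA vf_scale1 vf_scaleDr vf_scaleDl.

Lemma bracket_linear X Y : linear (fun f => X (Y f) - Y (X f)).
Proof. by move=> a f h; rewrite !vfP scalerBr opprD addrACA. Qed.
Lemma bracket_leibniz X Y f h : X (Y (f * h)) - Y (X (f * h)) =
  (X (Y f) - Y (X f)) * h + f * (X (Y h) - Y (X h)).
Proof.
rewrite !(vf_leibniz, vfD).
ring.
Qed.
Definition bracket X Y := VField (bracket_linear X Y) (bracket_leibniz X Y).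

End VectorFields.

(* Tensor fields are C^oo(M)-multilinear maps on vector fields; for a function
   F of vector fields, [F X p] is its value at the point p. *)
Section Geometry.
Context {R : realType} {m : nat} {M : manifold R m}.
Local Notation C := (Cinf M).
Local Notation VF := (vfield M).

Definition riemannian (g : VF -> VF -> C) : Prop :=
  [/\ forall X, scalar (g X),
      forall X Y, g X Y = g Y X,
      forall X p, 0 <= g X X p
    & forall X p, g X X p = 0 -> forall f : C, X f p = 0].

Definition ext_d (eta : VF -> C) (X Y : VF) : C :=
  X (eta Y) - Y (eta X) - eta (bracket X Y).

Definition wedge (eta zeta : VF -> C) (X Y : VF) : C :=
  eta X * zeta Y - eta Y * zeta X.

Definition three_form (w : VF -> VF -> VF -> C) : Prop :=
  [/\ forall Y Z, scalar (fun X => w X Y Z),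
      forall X Z, scalar (fun Y => w X Y Z),
      forall X Y, scalar (fun Z => w X Y Z)
    & forall X Y, [/\ w X X Y = 0, w X Y X = 0 & w Y X X = 0]].

Section Connections.
Implicit Types nabla : VF -> VF -> VF.

Definition connection nabla : Prop :=
  [/\ forall Y, linear (nabla^~ Y),
      forall X, {morph nabla X : Y Z / Y + Z}
    & forall (X : VF) (f : C) (Y : VF), nabla X (f *: Y) = X f *: Y + f *: nabla X Y].

Definition metric_connection (g : VF -> VF -> C) nabla : Prop :=
  connection nabla /\
  forall (X Y Z : VF), X (g Y Z) = g (nabla X Y) Z + g Y (nabla X Z).

Definition torsion nabla (X Y : VF) : VF :=
  nabla X Y - nabla Y X - bracket X Y.

Definition skew_torsion (g : VF -> VF -> C) nabla : Prop :=
  three_form (fun X Y Z => g (torsion nabla X Y) Z).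

Definition nabla_endo nabla (phi : VF -> VF) (X Y : VF) : VF :=
  nabla X (phi Y) - phi (nabla X Y).

Definition curvature nabla (X Y Z : VF) : VF :=
  nabla X (nabla Y Z) - nabla Y (nabla X Z) - nabla (bracket X Y) Z.

Definition orthonormal_at (g : VF -> VF -> C) (p : M) (e : 'I_m -> VF) :
  Prop := forall i j, g (e i) (e j) p = (i == j)%:R.

(* The contracted expression is a tensor, so its trace at p only depends on the
   values e_l(p) and may be computed with any fields that are orthonormal at p;
   such fields always exist, so the default value of [xget] is irrelevant. *)
Definition ricci (g : VF -> VF -> C) nabla (X Y : VF) (p : M) : R :=
  let e := xget (fun=> 0) [set e | orthonormal_at g p e] in
  \sum_(l < m) g (curvature nabla (e l) X Y) (e l) p.

Definition nabla_einstein (g : VF -> VF -> C) nabla : Prop :=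
  exists lambda : C, forall X Y p,
    (ricci g nabla X Y p + ricci g nabla Y X p) / 2 = lambda p * g X Y p.

Definition nabla_ricci_flat (g : VF -> VF -> C) nabla : Prop :=
  forall X Y p, ricci g nabla X Y p = 0.

End Connections.

Definition almost_contact_metric (phi : VF -> VF) (xi : VF) (eta : VF -> C)
    (g : VF -> VF -> C) : Prop :=
  [/\ forall X, phi (phi X) = - X + eta X *: xi,
      eta xi = 1
    & forall X Y, g (phi X) (phi Y) = g X Y - eta X * eta Y].

Definition fundamental_form (g : VF -> VF -> C) (phi : VF -> VF)
  (X Y : VF) : C := g X (phi Y).

Definition even_triple (i j k : 'I_3) : Prop :=
  exists s : 'S_3, [/\ ~~ odd_perm s, i = s 0, j = s 1 & k = s 2].

Section ThreeStructures.
Variables (phi : 'I_3 -> {linear VF -> VF}) (xi : 'I_3 -> VF).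
Variables (eta : 'I_3 -> {scalar VF}) (g : VF -> VF -> C).

Definition almost_3contact_metric : Prop :=
  [/\ riemannian g,
      forall i, almost_contact_metric (phi i) (xi i) (eta i) g
    & forall i j k, even_triple i j k ->
      [/\ forall X, phi k X = phi i (phi j X) - eta j X *: xi i,
          forall X, phi k X = - phi j (phi i X) + eta i X *: xi j,
          xi k = phi i (xi j) /\ xi k = - phi j (xi i)
        & forall X, eta k X = eta i (phi j X) /\ eta k X = - eta j (phi i X)]].

Definition sasaki_3_alpha_delta (alpha delta : R) : Prop :=
  [/\ almost_3contact_metric, alpha != 0
    & forall i j k, even_triple i j k -> forall X Y,
      ext_d (eta i) X Y =
        (2 * alpha) *: fundamental_form g (phi i) X Y
        + (2 * (alpha - delta)) *: wedge (eta j) (eta k) X Y].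

Definition canonical_connection (alpha delta : R) (nabla : VF -> VF -> VF) :
    Prop :=
  let beta := 2 * (delta - 2 * alpha) in
  [/\ metric_connection g nabla, skew_torsion g nabla
    & forall i j k, even_triple i j k -> forall X Y,
      nabla_endo nabla (phi i) X Y =
        (beta *: eta k X) *: phi j Y - (beta *: eta j X) *: phi k Y].

Definition proj_V (X : VF) : VF := \sum_(i < 3) g X (xi i) *: xi i.
Definition proj_H (X : VF) : VF := X - proj_V X.
Definition Id_V (X Y : VF) : C := g (proj_V X) (proj_V Y).
Definition Id_H (X Y : VF) : C := g (proj_H X) (proj_H Y).

End ThreeStructures.

End Geometry.

(* Main.v *)
(* The canonical connection has torsion
   [T = 2 alpha \sum_i eta_i /\ Phi_i + 2 (delta - alpha) eta_1 /\ eta_2 /\ eta_3]: its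
   components along the [xi_i] are read off from [d eta_i], and its horizontal part
   vanishes because [d (d eta_i) = 0].  Hence [T] is parallel, so the first Bianchi
   identity reads [R(X,Y)Z + cyc = T(T(X,Y),Z) + cyc], the curvature is
   symmetric in pairs and [Ric] is symmetric.  The formula for [nabla phi_i] gives
   the commutators of [R(X,Y)] with [phi_i] and its values on [xi_i]; the latter give
   [Ric(X, xi_i)].  For horizontal [X], [Y], contracting the Bianchi identity with
   [phi_i] yields [Ric(X, phi_i Y) - Ric(Y, phi_i X) = 2 lambda Phi_i(X, Y)], that is,
   [Ric - lambda g] changes sign under each [phi_i]; as [phi_3 = phi_1 phi_2] there, it
   vanishes.
   Vector fields being derivations, traces over orthonormal fields also require that
   at each point the values of vector fields form a space of dimension exactly the
   dimension of the manifold; this follows from bump functions and Hadamard's lemma. *)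

Require Import Defs.
From HB Require Import structures.
From mathcomp Require Import all_boot all_order all_algebra all_fingroup.
From mathcomp Require Import all_classical all_reals all_analysis.
From mathcomp Require Import ring.
Set Implicit Arguments.
Unset Strict Implicit.
Unset Printing Implicit Defensive.
Import Order.TTheory GRing.Theory Num.Theory.
Import numFieldNormedType.Exports.
Local Open Scope ring_scope.

(** Of the horizontal curvature only the commutators with the [phi i] are available. The accessible
    traces are therefore those in which some [phi i] occurs, and they reach only the part of [Ric]
    invariant under [phi i]; this is why the three structures are played against each other. The
    constant lambda adds up three traces: [R(X,Y)] against [phi i], the commutator of [R] with
    [phi i], and the quadratic torsion term. The parts in [n * alpha ^ 2] of the first and the last
    cancel. The commutators are governed by the curvature of the rotation connection with
    coefficients [beta * eta i], which is why they are multiples of [alpha * beta]. On the analytic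
    side a derivation acts on global functions only. Coordinates are thus available only after
    multiplication by a cutoff, and the cutoff survives as a factor in the frame identities. Frames
    are orthonormal at a single point, which suffices by tensoriality. *)

Section Analysis.
(** * Vector fields on a manifold span the tangent space *)
Local Open Scope classical_set_scope.
Local Open Scope ring_scope.

(** * Smooth functions on open sets of a real coordinate space *)

Section SmoothCalculus.
Context {R : realType}.

Lemma Ck_sub m k (V W : set 'rV[R]_m) f : W `<=` V -> Ck k V f -> Ck k W f.
Proof.
move=> WV; elim: k f => [|k IH] f /=; first by move=> fc x /WV; exact: fc.
by move=> [fd fk]; split=> [x /WV|i]; [exact: fd|exact: IH].
Qed.

Lemma Ck_local m k (V : set 'rV[R]_m) f :
  (forall x, V x -> exists2 W, W x & Ck k W f) -> Ck k V f.
Proof.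
elim: k f => [|k IH] f H; first by move=> x /H[W Wx fc]; exact: fc.
split=> [x /H[W Wx [fd _]]|i]; first exact: fd.
by apply: IH => x /H[W Wx [_ fk]]; exists W => //; exact: fk.
Qed.

Lemma diff_partial m (f : 'rV[R]_m -> R) x v : differentiable f x ->
  'd f x v = \sum_j v 0 j * partial j f x.
Proof.
move=> fx; rewrite {1}(row_sum_delta v) linear_sum; apply: eq_bigr => j _.
by rewrite linearZ /= /partial deriveE.
Qed.

Lemma differentiable_rV m p (T : 'rV[R]_m -> 'rV[R]_p) x :
  (forall j, differentiable (fun y => T y 0 j) x) -> differentiable T x.
Proof.
move=> Td; have -> : T = \sum_j (fun y => T y 0 j *: delta_mx 0 j).
  by apply/funext => y; rewrite fct_sumE -row_sum_delta.
by apply: differentiable_sum => j; apply: differentiableZl.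
Qed.

Lemma partial_comp m p (T : 'rV[R]_m -> 'rV[R]_p) (f : 'rV[R]_p -> R) x i :
  (forall j, differentiable (fun y => T y 0 j) x) -> differentiable f (T x) ->
  partial i (f \o T) x =
    \sum_j partial j f (T x) * partial i (fun y => T y 0 j) x.
Proof.
move=> Td fd; have Tx := differentiable_rV Td.
rewrite /partial deriveE; last exact: differentiable_comp.
rewrite diff_comp//= diff_partial//; apply: eq_bigr => j _.
rewrite mulrC; congr (_ * _); rewrite -deriveE//.
by rewrite derive_mx ?mxE//; exact: diff_derivable.
Qed.

Lemma CkSum m k (V : set 'rV[R]_m) n (F : 'I_n -> 'rV[R]_m -> R) : open V ->
  (forall j, Ck k V (F j)) -> Ck k V (\sum_j F j).
Proof.
move=> oV FC; elim/big_ind: _ => //; first exact: (Ck_cst k V 0).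
by move=> *; apply: CkD.
Qed.

(** The chain rule gives products of [partial j f \o T] with derivatives of coordinates of [T]: the
    order of [f] drops by one and the induction closes. *)
Lemma Ck_comp m p k (V : set 'rV[R]_m) (W : set 'rV[R]_p)
    (T : 'rV[R]_m -> 'rV[R]_p) (f : 'rV[R]_p -> R) : open V ->
  (forall x, V x -> W (T x)) -> (forall j, smooth_on V (fun y => T y 0 j)) ->
  Ck k W f -> Ck k V (f \o T).
Proof.
move=> oV TVW Ts.
have Td x : V x -> forall j, differentiable (fun y => T y 0 j) x.
  by move=> Vx j; have [+ _] := Ts j 1%N; exact.
elim: k f => [|k IH] f.
  move=> fc x Vx; apply: continuous_comp; last exact: fc (TVW _ Vx).
  exact/differentiable_continuous/differentiable_rV/Td.
move=> [fd fk]; split=> [x Vx|i].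
  by apply: differentiable_comp; [exact/differentiable_rV/Td|exact/fd/TVW].
have := CkSum oV (fun j => CkM oV (IH _ (fk j)) (proj2 (Ts j k.+1) i)).
apply: Ck_eq => // x Vx; rewrite fct_sumE partial_comp//; first exact: Td.
exact/fd/TVW.
Qed.

(** A whole sequence of successive derivatives is carried along, since the chain rule replaces [h n]
    by [h n.+1]. *)
Lemma smooth_comp1 m (V : set 'rV[R]_m) (h : nat -> R -> R) (u : 'rV[R]_m -> R) (n : nat) :
  open V -> (forall n (x : R), is_derive x (1 : R) (h n) (h n.+1 x)) ->
  smooth_on V u -> smooth_on V (h n \o u).
Proof.
move=> oV hd us k; elim: k n => [|k IH] n.
  move=> x Vx; apply: continuous_comp; first exact: us 0%N x Vx.
  by apply/differentiable_continuous/derivable1_diffP; case: (hd n (u x)).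
have ud x : V x -> differentiable u x by have [+ _] := us 1%N; exact.
have hdd n' x : differentiable (h n') (u x).
  by apply/derivable1_diffP; case: (hd n' (u x)).
split=> [x Vx|i]; first exact: differentiable_comp (ud x Vx) (hdd n x).
apply: Ck_eq (CkM oV (IH n.+1) (proj2 (us k.+1) i)) => // x Vx.
rewrite /partial deriveE; last exact: differentiable_comp (ud x Vx) (hdd n x).
rewrite diff_comp//=; last exact: ud.
rewrite diff1E; last exact: hdd.
rewrite derive1E (@derive_val _ _ _ _ _ _ _ (hd n (u x))) /= -deriveE; last exact: ud.
by rewrite [RHS]mulrC.
Qed.

Lemma partial_coord m i j (x : 'rV[R]_m) :
  partial i (fun y : 'rV[R]_m => y 0 j) x = (i == j)%:R.
Proof.
apply/cvg_lim => //=.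
apply: cvg_near_cst; near=> h; rewrite !mxE addrK eqxx /= eq_sym.
rewrite scalerA mulVf ?scale1r//.
by near: h; exact: nbhs_dnbhs_neq.
Unshelve. all: by end_near. Qed.

Lemma smooth_coord m (V : set 'rV[R]_m) j : smooth_on V (fun y => y 0 j).
Proof.
case=> [|k] /=; first by move=> x _; exact/differentiable_continuous/differentiable_coord.
split=> [x _|i]; first exact: differentiable_coord.
suff -> : partial i (fun y => y 0 j) = cst (i == j)%:R :> ('rV[R]_m -> R).
  exact: Ck_cst.
by apply/funext => x; rewrite partial_coord.
Qed.

End SmoothCalculus.

(** * Bump functions *)

Section Bump.
Context {R : realType}.

(* The functions [P(1/x) exp(-1/x)], extended by [0] to [x <= 0], form a family
   closed under differentiation. *)
Definition flat (P : {poly R}) (x : R) : R :=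
  if 0 < x then P.[x^-1] * expR (- x^-1) else 0.

(** Each monomial is dominated by one term of the exponential series at [x^-1]. The bound is linear
    in [x] so that it tends to zero at the origin. *)
Lemma flat_bound P : exists2 C, 0 <= C &
  forall x : R, 0 < x -> x <= 1 -> `|flat P x| <= C * x.
Proof.
exists (\sum_(i < size P) `|P`_i| * i.+2`!%:R).
  by apply: sumr_ge0 => i _; rewrite mulr_ge0.
move=> x x0 x1; rewrite /flat x0 horner_coef mulr_suml.
apply: le_trans (ler_norm_sum _ _ _) _; rewrite mulr_suml; apply: ler_sum => i _.
have s0 : 0 < x^-1 by rewrite invr_gt0.
have f0 : 0 < i.+2`!%:R :> R by rewrite ltr0n fact_gt0.
rewrite !normrM -!mulrA ler_wpM2l// normrX !gtr0_norm// ?expR_gt0//.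
rewrite expRN ler_pdivrMr ?expR_gt0//.
have := expR_ge1Dxn i.+1 (ltW s0).
rewrite -(ler_pM2l (mulr_gt0 f0 x0)) => /(le_trans _); apply.
rewrite -subr_ge0; have -> : i.+2`!%:R * x * (1 + x^-1 ^+ i.+2 / i.+2`!%:R) - x^-1 ^+ i =
  i.+2`!%:R * x + x^-1 ^+ i * (x^-1 - 1).
  rewrite !exprS; field; rewrite (lt0r_neq0 x0)/= (lt0r_neq0 f0)//.
rewrite addr_ge0 ?mulr_ge0 ?exprn_ge0 ?(ltW f0) ?(ltW x0) ?(ltW s0)//.
by rewrite subr_ge0 invf_ge1.
Qed.

Lemma is_derive_flat (P : {poly R}) (x : R) :
  is_derive x (1 : R) (flat P) (flat ('X^2 * (P - P^`())) x).
Proof.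
case: (ltgtP x 0) => [x0|x0|->].
- apply: (@near_eq_is_derive _ _ _ (cst 0)); last first.
    by rewrite /flat lt_gtF//; exact: is_derive_cst.
  near=> y; rewrite /flat lt_gtF//; near: y; exact: lt_nbhsl.
- apply: (@near_eq_is_derive R R^o R^o (fun y : R => P.[y^-1] * expR (- y^-1))).
    near=> y; rewrite /flat ifT//; near: y; exact: lt_nbhsr.
  have xn0 := lt0r_neq0 x0.
  have dV : is_derive x (1 : R) (fun y : R => y^-1) (- x ^- 2).
    by rewrite -[X in is_derive _ _ _ X]scaler1; exact: (@is_deriveV _ id).
  have dNV : is_derive x (1 : R) (fun y : R => - y^-1) (x ^- 2).
    by rewrite -[X in is_derive _ _ _ X]opprK; exact: is_deriveN.
  have d1 := @is_derive1_comp _ (horner P) (fun y : R => y^-1) x _ _ (is_derive_poly P x^-1) dV.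
  have d2 := @is_derive1_comp _ expR (fun y : R => - y^-1) x _ _ (is_derive_expR _) dNV.
  have d3 := is_deriveM d1 d2; apply: (@is_derive_eq _ _ _ _ _ _ _ _ d3).
  rewrite /flat x0 !hornerE.
  change (P.[x^-1] * (expR (- x^-1) / x ^+ 2) +
    expR (- x^-1) * (P^`().[x^-1] * - x ^- 2) =
    x^-1 ^+ 2 * (P.[x^-1] - P^`().[x^-1]) * expR (- x^-1)).
  by rewrite exprVn; ring.
(* At the origin the difference quotient of [flat P] is [flat ('X * P)] on the positive side and
   zero on the other. *)
- have [C C0 HC] := flat_bound ('X * P).
  have H : h^-1 *: ((flat P \o shift (0 : R)) (h *: (1 : R)) - flat P 0)
      @[h --> (0 : R)^'] --> (0 : R).
    apply/cvgrPdist_le => e e0; near=> h.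
    have -> : h^-1 *: ((flat P \o shift (0 : R)) (h *: (1 : R)) - flat P 0) = h^-1 * flat P h.
      by rewrite /= addr0 {2}/flat ltxx subr0; congr (_ * flat _ _); exact: mulr1.
    rewrite sub0r normrN.
    have [h0|h0] := ltP 0 h; last by rewrite /flat ltNge h0 mulr0 normr0 ltW.
    have hC : h <= e / (C + 1).
      rewrite (le_trans (ler_norm h))// ltW//; near: h; apply: dnbhs0_lt.
      by rewrite divr_gt0// ltr_wpDl.
    have h1 : h <= 1 by rewrite (le_trans (ler_norm h))//; near: h; exact: dnbhs0_le.
    have -> : h^-1 * flat P h = flat ('X * P) h by rewrite /flat h0 hornerM hornerX mulrA.
    rewrite (le_trans (HC h h0 h1))// (le_trans (ler_wpM2l C0 hC))//.
    rewrite mulrA ler_pdivrMr; last by rewrite ltr_wpDl.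
    by rewrite mulrC ler_wpM2l ?(ltW e0)// lerDl.
  by rewrite {2}/flat ltxx; apply: DeriveDef; [apply/cvg_ex; exists 0|exact: cvg_lim H].
Unshelve. all: by end_near. Qed.

Lemma smooth_bump m (a : 'rV[R]_m) (r : R) : 0 < r ->
  exists b : 'rV[R]_m -> R, [/\ smooth_on setT b, b a != 0 &
    forall y, b y != 0 -> ball a r y].
Proof.
move=> r0.
(* [b y = psi (r ^ 2 - |y - a| ^ 2)] with the Euclidean norm and
   [psi = exp(-1/x)]; it vanishes outside the sup-norm ball. *)
pose F n := flat (iter n (fun P => 'X^2 * (P - P^`())) 1).
pose u (y : 'rV[R]_m) := r ^+ 2 - \sum_j (y 0 j - a 0 j) ^+ 2.
have us : smooth_on setT u.
  move=> k; have sq j : Ck k setT (fun y : 'rV[R]_m => (y 0 j - a 0 j) ^+ 2).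
    have sj : Ck k setT ((fun y : 'rV[R]_m => y 0 j) + cst (- a 0 j)).
      by apply: CkD; [exact: openT|exact: smooth_coord|exact: Ck_cst].
    have := CkM openT sj sj; apply: Ck_eq; first exact: openT.
    by move=> y _; rewrite expr2.
  have := CkD openT (Ck_cst k setT (r ^+ 2)) (CkM openT (Ck_cst k setT (-1)) (CkSum openT sq)).
  apply: Ck_eq; first exact: openT.
  by move=> y _; rewrite /u !fctE fct_sumE mulN1r.
exists (F 0%N \o u); split.
- apply: smooth_comp1 => //; first exact: openT.
  by move=> n x; exact: is_derive_flat.
- rewrite /F /u /flat /= big1 ?subr0; last by move=> j _; rewrite subrr expr0n.
  by rewrite exprn_gt0// hornerE mul1r expR_eq0.
- move=> y; rewrite /F /u /flat /=; case: ifPn => [|_]; last by rewrite eqxx.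
  rewrite subr_gt0 => yr _; rewrite -ball_normE /= /Num.norm /= mx_normrE.
  apply/bigmax_ltP; split=> // -[i j] _ /=; rewrite !mxE ord1.
  rewrite -ltr_sqr ?nnegrE// ?ltW// real_normK ?num_real//.
  apply: le_lt_trans yr; rewrite (bigD1 j)//= -opprB sqrrN lerDl.
  by apply: sumr_ge0 => k _; exact: sqr_ge0.
Qed.

End Bump.

(** * Hadamard's lemma through integrals along rays *)

Section Hadamard.
Context {R : realType} {m : nat}.
Implicit Types (a y z v : 'rV[R]_m) (F f : 'rV[R]_m -> R).

Lemma coord_le_norm v j : `|v 0 j| <= `|v|.
Proof. by rewrite [leRHS]/Num.norm /= mx_normrE; exact: (le_bigmax _ _ (0, j)). Qed.

(** Meant for functions whose partial derivatives are guessed beforehand: a first-order estimate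
    yields differentiability and their values together. *)
Lemma differentiable_lin_approx f y (c : 'I_m -> R) :
  (forall e : R, 0 < e -> \forall z \near y,
     `|f z - f y - \sum_j (z - y) 0 j * c j| <= e * `|z - y|) ->
  differentiable f y /\ forall j, partial j f y = c j.
Proof.
move=> H.
have lin : linear (fun v => \sum_j v 0 j * c j).
  move=> t u v; rewrite scaler_sumr -big_split; apply: eq_bigr => j _ /=.
  by rewrite !mxE mulrDl [t *: _]mulrA.
pose Lm := GRing.isLinear.Build _ _ _ _ _ lin.
pose L : {linear 'rV[R]_m -> R} := HB.pack (fun v => \sum_j v 0 j * c j) Lm.
have Lc : continuous L.
  have -> : L = \sum_j (fun v => v 0 j * c j) :> ('rV[R]_m -> R).
    by apply/funext => v; rewrite fct_sumE.
  move=> v; apply/differentiable_continuous/differentiable_sum => j.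
  by apply: differentiableM; [exact: differentiable_coord|exact: differentiable_cst].
have e : f \o shift y = cst (f y) + L +o_ (0 : 'rV[R]_m) id.
  apply/eqaddoP => e e0.
  have := H e e0; rewrite (near_shift 0 y) /=; apply: filterS => z /=.
  by rewrite subr0 addrK !fctE /= opprD addrA.
have d : 'd f y = L :> ('rV[R]_m -> R) by exact: diff_unique.
have df : differentiable f y by apply/diff_locallyP; rewrite d.
split=> // j; rewrite /partial deriveE// d /= (bigD1 j)//= mxE !eqxx mul1r.
by rewrite big1 ?addr0// => i /negPf ij; rewrite mxE eqxx ij mul0r.
Qed.

Definition segm a y (t : R) : 'rV[R]_m := a + t *: (y - a).

Lemma continuous_segm a (u : 'rV[R]_m * R) :
  {for u, continuous (fun u => segm a u.1 u.2)}.
Proof.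
rewrite /prop_for /continuous_at /segm; apply: cvgD; first exact: cvg_cst.
apply: cvgZ; first exact: cvg_snd.
by apply: cvgB; [exact: cvg_fst|exact: cvg_cst].
Qed.

Lemma segm_continuous a y (t : R) : {for t, continuous (segm a y)}.
Proof.
rewrite /prop_for /continuous_at /segm; apply: cvgD; first exact: cvg_cst.
by apply: cvgZ; [exact: cvg_id|exact: cvg_cst].
Qed.

Lemma is_derive_line F (x w : 'rV[R]_m) (s : R) : differentiable F (x + s *: w) ->
  is_derive s (1 : R) (fun s : R => F (x + s *: w))
    (\sum_j w 0 j * partial j F (x + s *: w)).
Proof.
move=> dF; pose l (s : R) := x + s *: w.
have dl : differentiable l s.
  by apply: differentiableD; [exact: differentiable_cst|exact: differentiableZl].
have dc : differentiable (F \o l) s by exact: differentiable_comp.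
apply: DeriveDef; first exact/derivable1_diffP.
rewrite deriveE// diff_comp//= -diff_partial//; congr ('d F _ _).
rewrite -deriveE//; apply/cvg_lim => //; apply: cvg_near_cst; near=> h.
rewrite /l /= opprD addrACA subrr add0r -scalerBl addrK.
rewrite scalerA mulrA mulVf ?mul1r ?scale1r//.
by near: h; exact: nbhs_dnbhs_neq.
Unshelve. all: by end_near. Qed.

Variables (a : 'rV[R]_m) (V : set 'rV[R]_m).
Hypotheses (oV : open V)
  (starV : forall y t, V y -> 0 <= t <= 1 -> V (segm a y t)).

(** Compactness of the unit interval makes continuity along the segment uniform in [t]. *)
Lemma near_segm F y (e : R) : (forall x, V x -> {for x, continuous F}) ->
  V y -> 0 < e -> \forall z \near y, forall t, 0 <= t <= 1 ->
    `|F (segm a z t) - F (segm a y t)| <= e.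
Proof.
move=> Fc Vy e0.
have cov := iffLR (compact_near_coveringP _) (@segment_compact R 0 1).
have := cov _ (nbhs y) (fun z t => `|F (segm a z t) - F (segm a y t)| <= e) _.
move=> H; have : \forall z \near y,
    `[0, 1] `<=` (fun t => `|F (segm a z t) - F (segm a y t)| <= e).
  apply: H => t0 /= t01.
  have Vt : V (segm a y t0) by apply: starV => //; rewrite in_itv in t01.
  have e2 : 0 < e / 2 by rewrite divr_gt0.
  have near_t0 : \forall u \near ((y, t0) : 'rV[R]_m * R),
      `|F (segm a y t0) - F (segm a u.1 u.2)| <= e / 2.
    have cF : {for (y, t0), continuous (F \o (fun u : 'rV[R]_m * R => segm a u.1 u.2))}.
      by apply: continuous_comp; [exact: continuous_segm|exact: Fc].
    by move/cvgrPdist_le : cF => /(_ _ e2).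
  have near_t1 : \forall t \near t0, `|F (segm a y t0) - F (segm a y t)| <= e / 2.
    have cF : {for t0, continuous (F \o segm a y)}.
      by apply: continuous_comp; [exact: segm_continuous|exact: Fc].
    by move/cvgrPdist_le : cF => /(_ _ e2).
  have [[A B] /= [nA nB] AB] := near_t0.
  exists ([set t | `|F (segm a y t0) - F (segm a y t)| <= e / 2] `&` B, A) => /=.
    by split=> //; apply: filterI.
  move=> [t z] /= [[h1 Bt] Az]; rewrite (splitr e).
  rewrite -(subrKA (F (segm a y t0))) (le_trans (ler_normD _ _))// lerD//.
  by rewrite distrC; exact: (AB (z, t)).
by apply: filterS => z zt t t01; apply: zt; rewrite /= in_itv.
Qed.

Notation mu := (@lebesgue_measure R).

(** The weight [t ^+ k] closes the family under differentiation: each derivative in [y] brings out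
    one factor [t]. *)
Definition ray_int (k : nat) F y : R :=
  \int[mu]_(t in `[0, 1]) (t ^+ k * F (segm a y t)).

Lemma within_01_continuous (h : R -> R) :
  (forall t, 0 <= t <= 1 -> {for t, continuous h}) ->
  {within `[0, 1], continuous h}.
Proof.
move=> hc; apply: continuous_in_subspaceT => t.
by rewrite inE /= in_itv; exact: hc.
Qed.

Lemma integrable_01 (h : R -> R) :
  (forall t, 0 <= t <= 1 -> {for t, continuous h}) ->
  mu.-integrable `[0, 1] (EFin \o h).
Proof.
move=> hc; apply: continuous_compact_integrable; first exact: segment_compact.
exact: within_01_continuous.
Qed.

Lemma Rintegral_01_bound (h : R -> R) (e : R) :
  (forall t, 0 <= t <= 1 -> {for t, continuous h}) ->
  (forall t, 0 <= t <= 1 -> `|h t| <= e) ->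
  `|\int[mu]_(t in `[0, 1]) h t| <= e.
Proof.
move=> hc he; have mD : measurable (`[0, 1]%classic : set R) by exact: measurable_itv.
have ih := integrable_01 hc.
have ni : `|\int[mu]_(t in `[0, 1]) h t| <= \int[mu]_(t in `[0, 1]) `|h t|.
  by exact: le_normr_Rintegral.
apply: (le_trans ni).
have -> : e = \int[mu]_(t in `[0, 1]) e.
  rewrite Rintegral_cst//.
  rewrite -[LHS]mulr1; congr (_ * _).
  have := @lebesgue_measure_itv R `[0%R, 1%R]; rewrite /= lte_fin ltr01 => m01.
  by rewrite [X in fine X](m01 : _ = _) /= subr0.
apply: le_Rintegral => //.
- exact: integrable_norm.
- by apply: integrable_01 => t _; exact: cst_continuous.
Qed.

Lemma sum_continuous_01 n (w : 'I_n -> R) (c : 'I_n -> R -> R) (r : seq 'I_n) :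
  (forall j t, 0 <= t <= 1 -> {for t, continuous (c j)}) ->
  forall t, 0 <= t <= 1 -> {for t, continuous (fun t => \sum_(j <- r) w j * c j t)}.
Proof.
move=> cc t t01; elim: r => [|j r IH].
  under [X in {for _, continuous X}]eq_fun do rewrite big_nil.
  exact: cst_continuous.
under [X in {for _, continuous X}]eq_fun do rewrite big_cons.
by apply: cvgD => //; apply: cvgM; [exact: cvg_cst|exact: cc].
Qed.

Lemma Rintegral_01_sum n (w : 'I_n -> R) (c : 'I_n -> R -> R) (r : seq 'I_n) :
  (forall j t, 0 <= t <= 1 -> {for t, continuous (c j)}) ->
  \int[mu]_(t in `[0, 1]) (\sum_(j <- r) w j * c j t) =
  \sum_(j <- r) w j * \int[mu]_(t in `[0, 1]) c j t.
Proof.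
move=> cc; have mD : measurable (`[0, 1]%classic : set R) by exact: measurable_itv.
have ic j : mu.-integrable `[0, 1] (EFin \o c j) by apply: integrable_01; exact: cc.
elim: r => [|j r IH].
  under eq_Rintegral do rewrite big_nil.
  by rewrite big_nil Rintegral_cst// mul0r.
under eq_Rintegral do rewrite big_cons.
rewrite big_cons RintegralD//; last 2 first.
- by apply: integrable_01 => t t01; apply: cvgM; [exact: cvg_cst|exact: cc].
- by apply: integrable_01; exact: sum_continuous_01.
by rewrite IH RintegralZl.
Qed.

Lemma ray_integrand_continuous (k : nat) F y (t : R) : (forall x, V x -> {for x, continuous F}) ->
  V y -> 0 <= t <= 1 -> {for t, continuous (fun t : R => t ^+ k * F (segm a y t))}.
Proof.
move=> Fc Vy t01; rewrite /prop_for /continuous_at; apply: cvgM.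
  exact: exprn_continuous.
apply: (@continuous_comp _ _ _ (segm a y) F); first exact: segm_continuous.
exact/Fc/starV.
Qed.

Lemma ray_int_continuous k F y : (forall x, V x -> {for x, continuous F}) ->
  V y -> {for y, continuous (ray_int k F)}.
Proof.
move=> Fc Vy.
rewrite /prop_for /continuous_at.
apply/(@cvgrPdist_le _ _ _ _ (nbhs_filter y)) => e e0.
have mD : measurable (`[0, 1]%classic : set R) by exact: measurable_itv.
have nV : nbhs y V by exact: open_nbhs_nbhs.
apply: (@filterS2 _ _ (nbhs_filter y) _ _ _ _ nV (near_segm Fc Vy e0)) => z Vz zt.
have cI z t := @ray_integrand_continuous k F z t Fc.
rewrite /ray_int -RintegralB//; [|by apply: integrable_01 => *; exact: cI..].
apply: Rintegral_01_bound => t t01; first by apply: cvgB; exact: cI.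
have /andP[t0 t1] := t01.
rewrite -mulrBr normrM ger0_norm ?exprn_ge0// distrC.
rewrite (le_trans _ (zt t t01))// ler_piMl// exprn_ile1//.
Qed.

Lemma ray_int_differentiable (k : nat) F y : Ck 1 V F -> V y ->
  differentiable (ray_int k F) y /\
  forall j, partial j (ray_int k F) y = ray_int k.+1 (partial j F) y.
Proof.
move=> FC Vy; have [Fd Fk] := FC; apply: differentiable_lin_approx => e e0.
have Fc := CkS FC.
have mD : measurable (`[0, 1]%classic : set R) by exact: measurable_itv.
(* The sum to be bounded has [m] terms; [m.+1] keeps the denominator nonzero when [m = 0]. *)
have e'0 : 0 < e / m.+1%:R by rewrite divr_gt0.
have : \forall z \near y, V z /\ forall (j : 'I_m) t, 0 <= t <= 1 ->
    `|partial j F (segm a z t) - partial j F (segm a y t)| <= e / m.+1%:R.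
  apply: (@filterI _ _ (nbhs_filter y)); first exact: open_nbhs_nbhs.
  have : forall j, \forall z \near y, forall t, 0 <= t <= 1 ->
      `|partial j F (segm a z t) - partial j F (segm a y t)| <= e / m.+1%:R.
    by move=> j; apply: near_segm => //; exact: Fk.
  by move/(@filter_forall _ _ _ _ (nbhs_filter y)).
move/nbhs_ballP => [d /= d0 H]; apply/nbhs_ballP; exists d => //= z yz.
have Hz s : 0 <= s <= 1 -> ball y d (segm y z s).
  move=> /andP[s0 s1]; move: yz; rewrite -ball_normE /= /segm opprD addNKr normrN.
  rewrite normrZ ger0_norm// distrC; apply: le_lt_trans.
  by rewrite ler_piMl.
have Vz : V z by have [] := H z yz.
have cI := @ray_integrand_continuous.
pose c j t := t ^+ k.+1 * partial j F (segm a y t).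
have ccont j t : 0 <= t <= 1 -> {for t, continuous (c j)}.
  by move=> t01; apply: cI => //; exact: Fk.
have -> : \sum_j (z - y) 0 j * ray_int k.+1 (partial j F) y =
    \int[mu]_(t in `[0, 1]) (\sum_j (z - y) 0 j * c j t).
  by rewrite Rintegral_01_sum.
have scont t : 0 <= t <= 1 -> {for t, continuous (fun t => \sum_j (z - y) 0 j * c j t)}.
  exact: sum_continuous_01.
rewrite /ray_int -RintegralB//; [|by apply: integrable_01 => *; exact: cI..].
rewrite -RintegralB//; last 2 first.
- by apply: integrable_01 => t t01; apply: cvgB; exact: cI.
- exact: integrable_01.
apply: Rintegral_01_bound => t t01.
  by apply: cvgB; [apply: cvgB; exact: cI|exact: scont].
have /andP[t0 t1] := t01.
pose x0 := segm a y t; pose w := t *: (z - y).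
have xw (s : R) : x0 + s *: w = segm a (segm y z s) t.
  rewrite /x0 /w /segm scalerA [s * t]mulrC -scalerA -addrA -scalerDr.
  by rewrite [y + _ - a]addrAC.
pose S := \sum_j w 0 j * partial j F x0.
(* With the linear part at [x0] subtracted, the mean value theorem bounds the remainder by the
   variation of the partial derivatives between [x0] and an intermediate point. *)
pose G (s : R) := F (x0 + s *: w) - s * S.
have GD (s : R) : 0 <= s <= 1 ->
    is_derive s (1 : R) G (\sum_j w 0 j * partial j F (x0 + s *: w) - S).
  move=> s01; have VS : V (x0 + s *: w).
    by rewrite xw; apply: starV => //; case: (H _ (Hz s s01)).
  apply: is_deriveB; first by apply: is_derive_line; exact: Fd.
  have dS := is_deriveM (is_derive_id s (1 : R)) (is_derive_cst S s (1 : R)).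
  by apply: (@is_derive_eq _ _ _ _ _ _ _ _ dS); rewrite scaler0 add0r; exact: mulr1.
have [||s0 s01 GE] := @MVT_segment R G
  (fun s : R => \sum_j w 0 j * partial j F (x0 + s *: w) - S) 0 1 ler01.
- by move=> s s01; apply: GD; move: s01; rewrite in_itv /= => /andP[? ?]; rewrite !ltW.
- apply: within_01_continuous => s /GD [dG _].
  exact/differentiable_continuous/derivable1_diffP.
rewrite in_itv /= in s01.
have -> : t ^+ k * F (segm a z t) - t ^+ k * F (segm a y t)
    - \sum_j (z - y) 0 j * c j t = t ^+ k * (G 1 - G 0).
  rewrite /G scale0r addr0 mul0r subr0 mul1r xw.
  have -> : segm y z 1 = z by rewrite /segm scale1r addrC subrK.
  have -> : \sum_j (z - y) 0 j * c j t = t ^+ k * S.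
    rewrite mulr_sumr; apply: eq_bigr => j _; rewrite /c /w !mxE exprSr.
    by rewrite -/x0; ring.
  by rewrite /x0; ring.
rewrite GE subr0 mulr1 -sumrB normrM ger0_norm ?exprn_ge0//.
apply: (@le_trans _ _ `|\sum_j (w 0 j * partial j F (x0 + s0 *: w) - w 0 j * partial j F x0)|).
  by rewrite ler_piMl// exprn_ile1.
apply: le_trans (ler_norm_sum _ _ _) _.
apply: (@le_trans _ _ (\sum_(j < m) (e / m.+1%:R * `|z - y|))).
  apply: ler_sum => j _; rewrite -mulrBr normrM mulrC ler_pM//.
    by rewrite xw; case: (H _ (Hz _ s01)) => _; exact.
  rewrite /w mxE normrM ger0_norm// (le_trans _ (coord_le_norm _ j))//.
  by rewrite ler_piMl.
rewrite sumr_const card_ord -mulrnAl ler_wpM2r// -mulrnAr -mulr_natr.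
rewrite ler_piMr ?(ltW e0)// mulrC ler_pdivrMr// mul1r ler_nat; exact: leqnSn.
Qed.

Lemma smooth_partial F j : smooth_on V F -> smooth_on V (partial j F).
Proof. by move=> Fs k; have [_] := Fs k.+1; exact. Qed.

Lemma ray_int_smooth (k : nat) F : smooth_on V F -> smooth_on V (ray_int k F).
Proof.
move=> Fs c; elim: c k F Fs => [|c IH] k F Fs.
  by move=> y Vy; apply: ray_int_continuous Vy => //; exact: Fs 0%N.
split=> [y Vy|j]; first by have [] := ray_int_differentiable k (Fs 1%N) Vy.
have := IH k.+1 _ (smooth_partial j Fs); apply: Ck_eq => // y Vy.
by have [_ ->] := ray_int_differentiable k (Fs 1%N) Vy.
Qed.

(** The difference [F y - F a] is the integral of the derivative of [F] along the ray from [a] to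
    [y]; the factors [(y - a) 0 j] come out of the integral. *)
Lemma hadamard F : smooth_on V F -> V a ->
  exists h : 'I_m -> 'rV[R]_m -> R, [/\ forall j, smooth_on V (h j),
    forall j, h j a = partial j F a
    & forall y, V y -> F y = F a + \sum_j (y - a) 0 j * h j y].
Proof.
move=> Fs Va; exists (fun j => ray_int 0 (partial j F)).
have cst01 c : \int[mu]_(t in `[0, 1]) c = c.
  rewrite Rintegral_cst// -[RHS]mulr1; congr (_ * _).
  have := @lebesgue_measure_itv R `[0%R, 1%R]; rewrite /= lte_fin ltr01 => m01.
  by rewrite [X in fine X](m01 : _ = _) /= subr0.
split=> [j|j|y Vy].
- exact/ray_int_smooth/smooth_partial.
- rewrite /ray_int -[RHS]cst01; apply: eq_Rintegral => t _.
  by rewrite mul1r /segm subrr scaler0 addr0.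
have [Fd Fk] := Fs 1%N.
pose c j (t : R) := t ^+ 0 * partial j F (segm a y t).
have cc j t : 0 <= t <= 1 -> {for t, continuous (c j)}.
  by move=> t01; apply: ray_integrand_continuous => //; exact: Fk.
pose G (t : R) := F (a + t *: (y - a)).
have GD (t : R) : 0 <= t <= 1 -> is_derive t (1 : R) G (\sum_j (y - a) 0 j * c j t).
  move=> t01; under eq_bigr do rewrite /c mul1r.
  by apply: is_derive_line; apply: Fd; exact: starV.
have Gc (t : R) : 0 <= t <= 1 -> {for t, continuous G}.
  by move=> /GD [dG _]; exact/differentiable_continuous/derivable1_diffP.
have -> : F y = G 1 by rewrite /G scale1r addrC subrK.
have -> : F a = G 0 by rewrite /G scale0r addr0.
apply/eqP; rewrite addrC -subr_eq; apply/eqP.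
rewrite -Rintegral_01_sum// /Rintegral.
rewrite (@continuous_FTC2 _ _ G)//.
- by apply: within_01_continuous; exact: sum_continuous_01.
- split.
  + by move=> t; rewrite in_itv /= => /andP[t0 t1]; have [|] := GD t; rewrite ?ltW.
  + by apply: cvg_at_right_filter; apply: Gc; rewrite lexx ler01.
  + by apply: cvg_at_left_filter; apply: Gc; rewrite lexx ler01.
- move=> t; rewrite in_itv /= => /andP[t0 t1].
  by rewrite derive1E (@derive_val _ _ _ _ _ _ _ (GD t _))// !ltW.
Qed.

End Hadamard.

(** * Evaluation of functions and fields at a point *)

Section Evaluation.
Context {R : realType} {m : nat} {M : manifold R m}.
Implicit Types (f h : Cinf M) (X : vfield M) (p : M).

Lemma evD f h p : (f + h) p = f p + h p. Proof. by []. Qed.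
Lemma evN f p : (- f) p = - f p. Proof. by []. Qed.
Lemma evM f h p : (f * h) p = f p * h p. Proof. by []. Qed.
Lemma evZ (a : R) f p : (a *: f) p = a * f p. Proof. by []. Qed.
Lemma ev1 p : (1 : Cinf M) p = 1. Proof. by []. Qed.
Lemma ev0 p : (0 : Cinf M) p = 0. Proof. by []. Qed.
Lemma ev_sum (I : Type) (s : seq I) (P : pred I) (F : I -> Cinf M) p :
  (\sum_(i <- s | P i) F i) p = \sum_(i <- s | P i) F i p.
Proof. by elim/big_rec2: _ => // i u v _ <-. Qed.
Lemma ev_vfsum (I : Type) (s : seq I) (P : pred I) (X : I -> vfield M) f :
  (\sum_(i <- s | P i) X i) f = \sum_(i <- s | P i) X i f.
Proof. by elim/big_rec2: _ => // i u v _ <-. Qed.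
Lemma vf_sum X (I : Type) (s : seq I) (P : pred I) (F : I -> Cinf M) :
  X (\sum_(i <- s | P i) F i) = \sum_(i <- s | P i) X (F i).
Proof. by apply: big_morph; [exact: vfD|exact: vf0]. Qed.
Lemma vfZ X (a : R) f : X (a *: f) = a *: X f.
Proof. by rewrite -[a *: f]addr0 vfP vf0 addr0. Qed.
Definition evE := (evD, evN, evM, evZ, ev1, ev0, ev_sum).

End Evaluation.

(** * Cutoff coordinates and coordinate fields on the whole manifold *)

Section Extension.
Context {R : realType} {m : nat} (M : manifold R m) (c0 : chart R m M).
Variables (a : 'rV[R]_m) (r r0 : R) (beta : 'rV[R]_m -> R).
Hypotheses (c0A : atlas c0) (r_gt0 : 0 < r) (rr0 : r < r0).
Hypothesis ball_img : ball a r0 `<=` chart_img c0.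
Hypothesis beta_smooth : smooth_on setT beta.
Hypothesis beta_supp : forall y, beta y != 0 -> ball a r y.

Definition extend (h : 'rV[R]_m -> R) (q : M) : R :=
  if `[< chart_dom c0 q >] then beta (chart_map c0 q) * h (chart_map c0 q) else 0.

Lemma extendE h q : chart_dom c0 q ->
  extend h q = beta (chart_map c0 q) * h (chart_map c0 q).
Proof. by rewrite /extend => /asboolP ->. Qed.

Lemma chart_imgP (c : chart R m M) y : chart_img c y ->
  chart_dom c (chart_inv c y) /\ chart_map c (chart_inv c y) = y.
Proof. by move=> [x Dx <-]; rewrite chart_mapK. Qed.

Lemma chart_preimage_open (c : chart R m M) (U : set M) : open U ->
  open (chart_img c `&` chart_inv c @^-1` U).
Proof.
move=> oU; rewrite openE => y [yI Uy]; rewrite /interior.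
apply: (@filterI _ _ (nbhs_filter y)).
  by apply: open_nbhs_nbhs; split => //; exact: chart_img_open.
by apply: (chart_inv_continuous yI); exact: open_nbhs_nbhs.
Qed.

Lemma chart_map_preimage_open (c : chart R m M) (U : set 'rV[R]_m) : open U ->
  open (chart_dom c `&` chart_map c @^-1` U).
Proof.
move=> oU; rewrite openE => q [qD Uq]; rewrite /interior.
apply: (@filterI _ _ (nbhs_filter q)).
  by apply: open_nbhs_nbhs; split => //; exact: chart_dom_open.
by apply: (chart_map_continuous qD); exact: open_nbhs_nbhs.
Qed.

(* Points outside [chart_dom c0] have a neighbourhood missing this set because it
   is compact in a Hausdorff space; hence extending by zero is smooth. *)
Lemma closed_core : closed (chart_inv c0 @` closed_ball a r).
Proof.
apply: compact_closed; first exact: manifold_hausdorff.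
apply: continuous_compact.
  apply: continuous_in_subspaceT => y; rewrite inE => yb.
  apply: chart_inv_continuous; apply: ball_img.
  exact: closed_ball_subset yb.
apply: bounded_closed_compact; last exact: closed_ball_closed.
exists (`|a| + r0); split; first exact: num_real.
move=> x rx y /(closed_ball_subset r_gt0 rr0); rewrite -ball_normE /= => yb.
rewrite (le_trans _ (ltW rx))// -[y](subrKC a) (le_trans (ler_normD _ _))//.
by rewrite lerD2l distrC ltW.
Qed.

Lemma extend_smooth h : smooth_on (ball a r0) h -> smooth (extend h).
Proof.
move=> hs c cA k; apply: Ck_local => y yI.
have [qD cq] := chart_imgP yI; set q := chart_inv c y in qD cq.
(* Inside the ball the extension is a product of smooth functions read in [c0]; elsewhere [q] avoids
   the closed core, off which the extension vanishes. *)
have [qA|qB] := pselect (chart_dom c0 q /\ ball a r0 (chart_map c0 q)).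
  exists (chart_img c `&` chart_inv c @^-1` (chart_dom c0 `&` chart_map c0 @^-1` ball a r0)) => //.
  set W := (X in Ck _ X _).
  have oW : open W by apply/chart_preimage_open/chart_map_preimage_open/ball_open.
  have : Ck k W ((beta * h) \o (chart_map c0 \o chart_inv c)).
    apply: (@Ck_comp _ _ _ k W (ball a r0)) => //.
    - by move=> z [_ []].
    - move=> j l; have := atlas_compatible cA c0A j l.
      apply: Ck_sub => z [zI [zD _]]; have [zD' zE] := chart_imgP zI.
      by exists (chart_inv c z).
    - apply: CkM; [exact: ball_open| |exact: hs].
      by apply: Ck_sub (beta_smooth k).
  by apply: Ck_eq => // z [_ [zD _]]; rewrite /= extendE.
exists (chart_img c `&` chart_inv c @^-1` (~` (chart_inv c0 @` closed_ball a r))).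
  split=> //; apply: contra_not qB => -[z zb zE].
  have zB := closed_ball_subset r_gt0 rr0 zb.
  by have [] := chart_imgP (ball_img zB); rewrite zE => ? ->.
set W := (X in Ck _ X _).
have oW : open W by apply: chart_preimage_open; apply: closed_openC; exact: closed_core.
apply: (Ck_eq oW _ (Ck_cst k W 0)) => z [_ zK] /=.
rewrite /extend; case: asboolP => // zD.
have [->|/beta_supp zb] := eqVneq (beta (chart_map c0 (chart_inv c z))) 0.
  by rewrite mul0r.
case: zK; exists (chart_map c0 (chart_inv c z)); last by rewrite chart_mapK.
exact: subset_closed_ball zb.
Qed.

Lemma extend_pred h : smooth_on (ball a r0) h -> extend h \in @smooth_pred _ _ M.
Proof. by move=> hs; apply/asboolP/extend_smooth. Qed.

Definition extendC h (hs : smooth_on (ball a r0) h) : Cinf M :=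
  SmoothFun (extend_pred hs).

Lemma smooth_chart (f : Cinf M) : smooth_on (ball a r0) (f \o chart_inv c0).
Proof.
move=> k; apply: Ck_sub ball_img _; have /asboolP fs := Cinf_smooth f.
exact: fs c0 c0A k.
Qed.

Lemma smooth_chart_partial (f : Cinf M) i :
  smooth_on (ball a r0) (partial i (f \o chart_inv c0)).
Proof. by apply: smooth_partial; exact: smooth_chart. Qed.

Definition coord_field_fun i (f : Cinf M) : Cinf M := extendC (smooth_chart_partial f i).

Lemma chart_differentiable (f : Cinf M) q : chart_dom c0 q ->
  differentiable (f \o chart_inv c0) (chart_map c0 q).
Proof.
move=> qD; have /asboolP fs := Cinf_smooth f.
by have [+ _] := fs c0 c0A 1%N; apply; exists q.
Qed.

Lemma coord_field_linear i : linear (coord_field_fun i).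
Proof.
move=> u f h; apply/Cinf_eqP => q /=.
change (extend (partial i (u *: (f \o chart_inv c0) + (h \o chart_inv c0))) q =
  u * extend (partial i (f \o chart_inv c0)) q + extend (partial i (h \o chart_inv c0)) q).
have [qD|nD] := pselect (chart_dom c0 q); last first.
  by rewrite /extend; case: asboolP => // _; rewrite mulr0 addr0.
have df := diff_derivable (chart_differentiable f qD).
have dh := diff_derivable (chart_differentiable h qD).
rewrite !extendE// /partial deriveD//; last exact: derivableZ.
rewrite deriveZ// mulrDr; congr (_ + _).
exact: (@mulrCA R (beta _) u).
Qed.

Lemma coord_field_leibniz i (f h : Cinf M) :
  coord_field_fun i (f * h) = coord_field_fun i f * h + f * coord_field_fun i h.
Proof.
apply/Cinf_eqP => q /=.
change (extend (partial i ((f \o chart_inv c0) * (h \o chart_inv c0))) q =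
  extend (partial i (f \o chart_inv c0)) q * h q + f q * extend (partial i (h \o chart_inv c0)) q).
have [qD|nD] := pselect (chart_dom c0 q); last first.
  by rewrite /extend; case: asboolP => // _; rewrite mul0r mulr0 addr0.
have df := diff_derivable (chart_differentiable f qD).
have dh := diff_derivable (chart_differentiable h qD).
rewrite !extendE// /partial deriveM// /= chart_mapK//.
rewrite mulrDr addrC; congr (_ + _); last exact: (@mulrCA R (beta _)).
by rewrite -mulrA; congr (_ * _); exact: (@mulrC R).
Qed.

Definition coord_field i : vfield M := VField (coord_field_linear i) (@coord_field_leibniz i).

Definition bump_fun : Cinf M := extendC (fun k => Ck_cst k (ball a r0) 1).

Definition coord_fun j : Cinf M := extendC (smooth_coord (ball a r0) j).

Lemma bump_funE q : chart_dom c0 q -> bump_fun q = beta (chart_map c0 q).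
Proof. by move=> qD /=; rewrite extendE// mulr1. Qed.

Lemma extend_bump0 h q : bump_fun q = 0 -> extend h q = 0.
Proof.
by rewrite /= /extend; case: asboolP => // _; rewrite mulr1 => ->; rewrite mul0r.
Qed.

Lemma bump_fun_neq0 q : bump_fun q != 0 ->
  chart_dom c0 q /\ ball a r0 (chart_map c0 q).
Proof.
rewrite /= /extend; case: asboolP => [qD|_]; last by rewrite eqxx.
by rewrite mulr1 => /beta_supp qb; split=> //; exact: le_ball (ltW rr0) _ qb.
Qed.

Lemma coord_fieldE i f q : chart_dom c0 q ->
  coord_field i f q = beta (chart_map c0 q) * partial i (f \o chart_inv c0) (chart_map c0 q).
Proof. by move=> qD /=; rewrite extendE. Qed.

Lemma ball_star y z t : ball a r0 y -> ball a r0 z -> 0 <= t <= 1 ->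
  ball a r0 (segm y z t).
Proof.
rewrite -!ball_normE /= /segm => yb zb /andP[t0 t1].
have -> : a - (y + t *: (z - y)) = (1 - t) *: (a - y) + t *: (a - z).
  rewrite scalerBl scale1r !scalerBr; apply/eqP; rewrite -subr_eq0; apply/eqP.
  by apply/rowP => j; rewrite !mxE; ring.
rewrite (le_lt_trans (ler_normD _ _))// !normrZ !ger0_norm ?subr_ge0//.
have [->|tn] := eqVneq t 0; first by rewrite mul0r addr0 subr0 mul1r.
have tp : 0 < t by rewrite lt0r tn.
rewrite -[ltRHS]mul1r -[X in X * r0](subrK t) [ltRHS]mulrDl ler_ltD//.
  by rewrite ler_wpM2l ?subr_ge0// ltW.
by rewrite ltr_pM2l.
Qed.

(* At a point [q] with [beta y <> 0], [y = chart_map c0 q], Hadamard's lemma gives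
   [beta ^ 2 f = f(q) beta ^ 2 + \sum_j beta (y_j - y_j(q)) (beta h_j)] globally,
   and [X] is applied to both sides: this determines [X f (q)] without assuming
   that [beta] is constant near [q]. *)
Lemma frame_expansion (X : vfield M) :
  bump_fun ^+ 3 *: X =
  \sum_j (bump_fun * X (coord_fun j) - coord_fun j * X bump_fun) *: coord_field j.
Proof.
apply: vfieldP => f; apply/Cinf_eqP => q.
rewrite ev_vfsum ev_sum.
change ((bump_fun ^+ 3 * X f) q = \sum_j
  (bump_fun * X (coord_fun j) - coord_fun j * X bump_fun) q * coord_field j f q).
have [b0|b0] := eqVneq (bump_fun q) 0.
  rewrite big1; first by rewrite exprS !evM b0 !mul0r.
  by move=> j _; rewrite [coord_field j f q]extend_bump0// mulr0.
have [qD qb] := bump_fun_neq0 b0; set y := chart_map c0 q in qb.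
have star z t : ball a r0 z -> 0 <= t <= 1 -> ball a r0 (segm y z t).
  exact: ball_star.
have [h [hs hy hE]] := hadamard (ball_open a _) star (smooth_chart f) qb.
pose H j := extendC (hs j).
have cq j : coord_fun j q = y 0 j * bump_fun q.
  by rewrite /= !extendE//= -/y mulr1 mulrC.
have fE : bump_fun * bump_fun * f = f q *: (bump_fun * bump_fun) +
    \sum_j (coord_fun j - y 0 j *: bump_fun) * H j.
  apply/Cinf_eqP => x; rewrite !evE.
  have [bx0|bx0] := eqVneq (bump_fun x) 0.
    rewrite bx0 big1 ?mul0r ?mulr0 ?addr0// => j _.
    by rewrite !evE [H j x]extend_bump0// mulr0.
  have [xD xb] := bump_fun_neq0 bx0.
  have -> : f x = (f \o chart_inv c0) (chart_map c0 x) by rewrite /= chart_mapK.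
  have fq : (f \o chart_inv c0) y = f q by rewrite /= chart_mapK.
  rewrite hE// mulrDr fq mulrC; congr (_ + _).
  rewrite mulr_sumr; apply: eq_bigr => j _.
  by rewrite evM evD evN evZ /= !extendE//= !mxE; ring.
have := congr1 (fun F : Cinf M => X F q) fE.
rewrite vfD vfZ vf_sum !vf_leibniz !evE => eqf.
have {eqf} key : bump_fun q * bump_fun q * X f q =
    \sum_j (X (coord_fun j) q - y 0 j * X bump_fun q) * coord_field j f q.
  apply: (@addrI _ ((X bump_fun q * bump_fun q + bump_fun q * X bump_fun q) * f q)).
  rewrite eqf mulrC; congr (_ + _); apply: eq_bigr => j _.
  rewrite !vf_leibniz -[in LHS]scaleN1r vfD vfZ vfZ !evE.
  rewrite cq; have -> : coord_field j f q = H j q.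
    by rewrite coord_fieldE//= extendE// -/y hy.
  by ring.
rewrite -[LHS]mulrA key mulr_sumr; apply: eq_bigr => j _.
have -> : (bump_fun * X (coord_fun j) - coord_fun j * X bump_fun) q =
  bump_fun q * (X (coord_fun j) q - y 0 j * X bump_fun q).
  by rewrite !evE cq; ring.
by rewrite mulrA.
Qed.

(** Quotient rule: where the cutoff is nonzero, [coord_fun j / bump_fun] is the true coordinate, and
    the left-hand side is [bump_fun ^+ 2] times its derivative. The third factor comes from the
    cutoff inside [coord_field i]. *)
Lemma frame_dual i j q : 
  (bump_fun * coord_field i (coord_fun j) - coord_fun j * coord_field i bump_fun) q
  = bump_fun q ^+ 3 * (i == j)%:R.
Proof.
rewrite !evE.
have [b0|b0] := eqVneq (bump_fun q) 0.
  by rewrite b0 [coord_fun j q]extend_bump0// exprS !mul0r oppr0 addr0.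
have [qD qb] := bump_fun_neq0 b0; set y := chart_map c0 q in qb.
have by1 : differentiable beta y by have [+ _] := beta_smooth 1%N; exact.
have dc : differentiable (fun y : 'rV[R]_m => y 0 j) y by exact: differentiable_coord.
have nI : nbhs y (chart_img c0).
  by apply: open_nbhs_nbhs; split; [exact: chart_img_open|exists q].
have Dext h hs i' : partial i' (@extendC h hs \o chart_inv c0) y = partial i' (beta * h) y.
  apply: near_eq_derive; apply: filterS nI => z /chart_imgP[zD zE].
  by rewrite /= extendE// zE.
rewrite !coord_fieldE// -/y !Dext.
have -> : beta * cst 1 = beta by apply/funext => z; exact: mulr1.
have -> : partial i (beta * (fun y : 'rV[R]_m => y 0 j)) y =
    beta y * (i == j)%:R + y 0 j * partial i beta y.
  by rewrite {1}/partial deriveM; [rewrite -!/(partial _ _ _) partial_coord|exact: diff_derivable..].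
rewrite bump_funE// -/y.
have -> : coord_fun j q = beta y * y 0 j by rewrite /= extendE.
by ring.
Qed.

End Extension.

(** The expansion shows that the [D j] span the values of vector fields at [p], the duality that
    they are independent there. *)
Lemma local_frame (R : realType) m (M : manifold R m) (p : M) :
  exists (b : Cinf M) (x : 'I_m -> Cinf M) (D : 'I_m -> vfield M),
    [/\ b p != 0,
      forall X : vfield M, b ^+ 3 *: X = \sum_j (b * X (x j) - x j * X b) *: D j
    & forall i j, (b * D i (x j) - x j * D i b) p = b p ^+ 3 * (i == j)%:R].
Proof.
have [c0 c0A p0] := atlas_cover p.
have : nbhs (chart_map c0 p) (chart_img c0).
  by apply: open_nbhs_nbhs; split; [exact: chart_img_open|exists p].
move=> /nbhs_ballP[r0 /= r00 br0].
have r_gt0 : 0 < r0 / 2 by rewrite divr_gt0.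
have rr0 : r0 / 2 < r0 by rewrite ltr_pdivrMr// ltr_pMr// ltr1n.
have [beta [bs b0 bsupp]] := smooth_bump (chart_map c0 p) r_gt0.
exists (bump_fun c0A r_gt0 rr0 br0 bs bsupp).
exists (coord_fun c0A r_gt0 rr0 br0 bs bsupp).
exists (coord_field c0A r_gt0 rr0 br0 bs bsupp); split.
- by rewrite bump_funE.
- exact: frame_expansion.
- by move=> i j; exact: frame_dual.
Qed.

(** * Linear algebra of tensors at a point *)

Section PointwiseTensors.
Context {R : realType} {m : nat} (M : manifold R m).
Local Notation C := (Cinf M).
Local Notation VF := (vfield M).
Implicit Types (X Y Z : VF) (theta : VF -> C).

Lemma scalar_comb theta n (c : 'I_n -> C) (X : 'I_n -> VF) : scalar theta ->
  theta (\sum_i c i *: X i) = \sum_i c i * theta (X i).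
Proof.
move=> ts; pose tM := GRing.isLinear.Build _ _ _ _ _ ts.
pose t : {scalar VF} := HB.pack theta tM.
change (t (\sum_i c i *: X i) = \sum_i c i * t (X i)).
by rewrite linear_sum; apply: eq_bigr => i _; exact: linearZ.
Qed.

Lemma scalar_fctB theta X Y : scalar theta -> theta (X - Y) = theta X - theta Y.
Proof.
move=> ts; pose tM := GRing.isLinear.Build _ _ _ _ _ ts.
pose t : {scalar VF} := HB.pack theta tM.
exact: (linearB t).
Qed.

Lemma scalar_fctZ theta a X : scalar theta -> theta (a *: X) = a * theta X.
Proof.
move=> ts; pose tM := GRing.isLinear.Build _ _ _ _ _ ts.
pose t : {scalar VF} := HB.pack theta tM.
by change (t (a *: X) = a * t X); rewrite linearZ.
Qed.

Variable p : M.

Definition rcomb n (c : 'I_n -> R) (X : 'I_n -> VF) : VF := \sum_i (c i)%:A *: X i.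

Lemma rcombE theta n (c : 'I_n -> R) (X : 'I_n -> VF) : scalar theta ->
  theta (rcomb c X) p = \sum_i c i * theta (X i) p.
Proof.
move=> ts; rewrite scalar_comb// ev_sum; apply: eq_bigr => i _.
by rewrite !evE mulr1.
Qed.

Lemma rcomb_ev n (c : 'I_n -> R) (X : 'I_n -> VF) f : rcomb c X f p = \sum_i c i * X i f p.
Proof.
rewrite ev_vfsum ev_sum; apply: eq_bigr => i _.
by change (((c i)%:A * X i f) p = c i * X i f p); rewrite !evE mulr1.
Qed.

Section Frame.
Variables (b : C) (x : 'I_m -> C) (D : 'I_m -> VF).
Hypothesis b0 : b p != 0.
Hypothesis frameE : forall X, b ^+ 3 *: X = \sum_j (b * X (x j) - x j * X b) *: D j.
Hypothesis frame_dual : forall i j,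
  (b * D i (x j) - x j * D i b) p = b p ^+ 3 * (i == j)%:R.

(** Components of [X] at [p] in the frame [D], multiplied by [b p ^+ 3]. *)
Definition coords X : 'rV[R]_m := \row_j (b * X (x j) - x j * X b) p.

Lemma coords0 X : (forall f, X f p = 0) -> coords X = 0.
Proof. by move=> X0; apply/rowP => j; rewrite !mxE !evE !X0 !mulr0 subr0. Qed.

Lemma coordsB X Y : coords (X - Y) = coords X - coords Y.
Proof.
apply/rowP => j; rewrite !mxE.
change ((b * (X (x j) - Y (x j)) - x j * (X b - Y b)) p = (b * X (x j) - x j * X b) p -
  (b * Y (x j) - x j * Y b) p).
by rewrite !evE; ring.
Qed.

Lemma coords_rcomb n (c : 'I_n -> R) (X : 'I_n -> VF) :
  coords (rcomb c X) = \sum_i c i *: coords (X i).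
Proof.
apply/rowP => j; rewrite summxE mxE !evE !rcomb_ev !mulr_sumr -sumrB.
by apply: eq_bigr => i _; rewrite !mxE !evE; ring.
Qed.

(** Tensoriality: [theta] passes through the expansion of [b ^+ 3 *: X], whose coefficients all
    vanish at [p], and [b p] is nonzero. *)
Lemma coords_tensor X theta : scalar theta -> coords X = 0 -> theta X p = 0.
Proof.
move=> ts /rowP X0; have := congr1 (fun Y => theta Y p) (frameE X).
rewrite -[b ^+ 3 *: X]addr0 ts scalar_comb// ev_sum big1; last first.
  by move=> j _; have := X0 j; rewrite !mxE evM => ->; rewrite mul0r.
have -> : theta 0 = 0 by rewrite -(subrr X) scalar_fctB// subrr.
rewrite !evE => /eqP; rewrite addr0 mulf_eq0 => /orP[|/eqP//].
by rewrite !mulf_eq0 (negPf b0).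
Qed.

Variable g : VF -> VF -> C.
Hypothesis gR : riemannian g.

(** Pairing with the [e k] makes their [m] coordinate vectors independent, hence a basis; the
    coefficients of [X] are then read off with [g]. *)
Lemma frame_parseval (e : 'I_m -> VF) theta X : orthonormal_at g p e -> scalar theta ->
  theta X p = \sum_l g (e l) X p * theta (e l) p.
Proof.
move=> oe ts; have [gl gC _ _] := gR.
pose E := \matrix_(l, j) coords (e l) 0 j : 'M[R]_m.
have EE (u : 'rV[R]_m) : u *m E = coords (rcomb (fun l => u 0 l) e).
  rewrite coords_rcomb mulmx_sum_row; apply: eq_bigr => l _; congr (_ *: _).
  by apply/rowP => j; rewrite !mxE.
have Ef : row_free E.
  apply/inj_row_free => u; rewrite EE => u0; apply/rowP => k; rewrite mxE.
  have := coords_tensor (gl (e k)) u0; rewrite rcombE// (bigD1 k)//= oe eqxx mulr1.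
  by rewrite big1 ?addr0// => i ik; rewrite oe eq_sym (negPf ik) mulr0.
rewrite row_free_unit in Ef.
pose c := coords X *m invmx E.
have cX : coords (X - rcomb (fun l => c 0 l) e) = 0.
  by rewrite coordsB -EE mulmxKV// subrr.
have key t : scalar t -> t X p = \sum_l c 0 l * t (e l) p.
  move=> tS; have := coords_tensor tS cX; rewrite scalar_fctB// evD evN rcombE// => /eqP.
  by rewrite subr_eq0 => /eqP.
rewrite key//; apply: eq_bigr => l _; congr (_ * _).
rewrite (key _ (gl (e l))) (bigD1 l)//= oe eqxx mulr1.
by rewrite big1 ?addr0// => i il; rewrite oe eq_sym (negPf il) mulr0.
Qed.

(** Some [D i] must leave a nonzero residual [W i]: otherwise a nonzero multiple of the identity of
    size [m] would factor through dimension [k < m]. *)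
Lemma gram_schmidt k : (k <= m)%N -> exists e : 'I_k -> VF,
  forall i j, g (e i) (e j) p = (i == j)%:R.
Proof.
have [gl gC gp g0] := gR.
elim: k => [|k IH] km; first by exists (fun=> 0) => -[].
have [e eO] := IH (ltnW km).
pose W i := D i - rcomb (fun l => g (e l) (D i) p) e.
have [i Wi] : exists i, g (W i) (W i) p != 0.
  apply: contrapT => /forallNP W0.
  have {}W0 i : coords (D i) = coords (rcomb (fun l => g (e l) (D i) p) e).
    apply/eqP; rewrite -subr_eq0 -coordsB; apply/eqP/coords0.
    by apply: g0; have /negP := W0 i; rewrite negbK => /eqP.
  pose A := \matrix_(i, l) g (e l) (D i) p : 'M[R]_(m, k).
  pose B := \matrix_(l, j) coords (e l) 0 j : 'M[R]_(k, m).
  have AB : A *m B = (b p ^+ 3)%:M.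
    apply/matrixP => i j; rewrite !mxE -mulr_natr -frame_dual.
    have := congr1 (fun v : 'rV[R]_m => v 0 j) (W0 i); rewrite mxE => ->.
    by rewrite coords_rcomb summxE; apply: eq_bigr => l _; rewrite !mxE.
  have : (\rank (A *m B) <= k)%N by rewrite (leq_trans (mxrankM_maxl _ _))// rank_leq_col.
  rewrite AB mxrank_unit; first by rewrite leqNgt km.
  by rewrite unitmxE det_scalar unitrX// unitfE expf_neq0.
have We l : g (e l) (W i) p = 0.
  rewrite scalar_fctB// evD evN rcombE// (bigD1 l)//= eO eqxx mulr1 big1 ?addr0 ?subrr//.
  by move=> j jl; rewrite eO eq_sym (negPf jl) mulr0.
pose s := Num.sqrt (g (W i) (W i) p).
have s0 : s != 0 by rewrite sqrtr_eq0 -ltNge lt0r Wi gp.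
have gZ Y : g Y (s^-1%:A *: W i) p = s^-1 * g Y (W i) p.
  by rewrite scalar_fctZ// !evE mulr1.
exists (fun j => if unlift ord_max j is Some l then e l else s^-1%:A *: W i).
move=> j1 j2; case: unliftP => [l1|] ->; case: unliftP => [l2|] ->.
- by rewrite eO (inj_eq lift_inj).
- by rewrite gZ We mulr0 eq_sym (negPf (neq_lift _ _)).
- by rewrite gC gZ We mulr0 (negPf (neq_lift _ _)).
- rewrite eqxx gZ gC gZ -[X in _ * (_ * X)]sqr_sqrtr ?gp// -/s.
  by rewrite expr2 mulKf// mulVf.
Qed.

End Frame.

Lemma orthonormal_exists g : riemannian g -> exists e, orthonormal_at g p e.
Proof.
move=> gR; have [b [x [D [b0 fE fd]]]] := local_frame p.
by have [e eO] := gram_schmidt b0 fd gR (leqnn m); exists e.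
Qed.

Lemma parseval g e theta X : riemannian g -> orthonormal_at g p e -> scalar theta ->
  theta X p = \sum_l g (e l) X p * theta (e l) p.
Proof.
move=> gR; have [b [x [D [b0 fE fd]]]] := local_frame p.
exact: (frame_parseval b0 fE gR).
Qed.

End PointwiseTensors.

End Analysis.

(** * Almost 3-contact metric structures and the canonical connection *)

Lemma even_triple_rot i j k : even_triple i j k -> even_triple j k i.
Proof.
move=> [s [se -> -> ->]].
(* The 3-cycle sending 0 to 1 to 2 to 0, written as two transpositions so that its parity is
   visible. *)
pose c : 'S_3 := mulg (tperm (0 : 'I_3) (1 : 'I_3)) (tperm (0 : 'I_3) (2 : 'I_3)).
exists (mulg c s); rewrite !odd_permM !odd_tperm /= (negPf se).
by split; rewrite // !permM; congr (s _); rewrite !permE.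
Qed.

Lemma sum_even_triple (V : nmodType) (F : 'I_3 -> V) i j k : even_triple i j k ->
  \sum_(l < 3) F l = F i + F j + F k.
Proof.
move=> [s [_ -> -> ->]]; rewrite (reindex_inj (@perm_inj _ s)) !big_ord_recl big_ord0 /= addr0 addrA.
by do 2?[congr (_ + _)]; congr (F (s _)); apply: val_inj.
Qed.

Lemma even_triple_ex : exists i j k, even_triple i j k.
Proof. by exists 0, 1, 2; exists 1%g; rewrite odd_perm1 !perm1. Qed.

(** * Algebraic identities of the three structures *)

Section Algebra.
Context {R : realType} {m : nat} {M : manifold R m}.
Local Notation C := (Cinf M).
Local Notation VF := (vfield M).
Implicit Types (X Y Z W : VF) (f h : C).

(** Smooth functions have zero divisors but no nilpotents, as is seen pointwise. *)
Lemma Cinf_sqr_eq0 f : f * f = 0 -> f = 0.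
Proof.
move=> /Cinf_eqP f0; apply/Cinf_eqP => p; have := f0 p; rewrite evM => /eqP.
by rewrite mulf_eq0 orbb => /eqP.
Qed.

Lemma Cinf_mulrn_eq0 f n : f *+ n.+1 = 0 -> f = 0.
Proof.
move=> /Cinf_eqP f0; apply/Cinf_eqP => p; have := f0 p.
have -> : (f *+ n.+1) p = f p *+ n.+1.
  by elim: (n.+1) => // k IH; rewrite mulrS evD IH mulrS.
by move/eqP; rewrite mulrn_eq0 => /eqP.
Qed.

Lemma vfB X f h : X (f - h) = X f - X h.
Proof. by rewrite vfD vfN. Qed.

Lemma vf_cst X (a : R) : X a%:A = 0.
Proof.
rewrite vfZ; have : X (1 * 1) = X 1 by rewrite mulr1.
rewrite vf_leibniz mulr1 mul1r => /eqP; rewrite -subr_eq0 addrK => /eqP ->.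
exact: scaler0.
Qed.

Variables (phi : 'I_3 -> {linear VF -> VF}) (xi : 'I_3 -> VF).
Variables (eta : 'I_3 -> {scalar VF}) (g : VF -> VF -> C).
Hypothesis gR : riemannian g.

Lemma metricC X Y : g X Y = g Y X. Proof. by case: gR. Qed.
Lemma metric_scalar X : scalar (g X). Proof. by case: gR. Qed.
Lemma metricDr X Y Z : g X (Y + Z) = g X Y + g X Z.
Proof. by rewrite -[Y]scale1r metric_scalar mul1r scale1r. Qed.
Lemma metricZr X f Y : g X (f *: Y) = f * g X Y.
Proof. exact: (scalar_fctZ f Y (metric_scalar X)). Qed.
Lemma metricNr X Y : g X (- Y) = - g X Y.
Proof. by rewrite -scaleN1r metricZr mulN1r. Qed.
Lemma metric0r X : g X 0 = 0. Proof. by rewrite -(scale0r X) metricZr mul0r. Qed.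
Lemma metricDl X Y Z : g (X + Y) Z = g X Z + g Y Z.
Proof. by rewrite metricC metricDr !(metricC Z). Qed.
Lemma metricNl X Y : g (- X) Y = - g X Y.
Proof. by rewrite metricC metricNr metricC. Qed.
Lemma metricZl f X Y : g (f *: X) Y = f * g X Y.
Proof. by rewrite metricC metricZr metricC. Qed.
Definition metricE := (metricDl, metricDr, metricNl, metricNr, metricZl, metricZr).

Lemma metric_inj X Y : (forall W, g X W = g Y W) -> X = Y.
Proof.
move=> XY; have [_ _ _ g0] := gR; apply/eqP; rewrite -subr_eq0; apply/eqP.
apply: vfieldP => f; apply/Cinf_eqP => p; apply: g0.
by rewrite metricDl metricNl XY subrr.
Qed.

Lemma etaD i X Y : eta i (X + Y) = eta i X + eta i Y. Proof. exact: linearD. Qed.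
Lemma etaN i X : eta i (- X) = - eta i X. Proof. exact: linearN. Qed.
Lemma etaZ i f X : eta i (f *: X) = f * eta i X. Proof. exact: linearZ. Qed.
Lemma phiD i X Y : phi i (X + Y) = phi i X + phi i Y. Proof. exact: linearD. Qed.
Lemma phiN i X : phi i (- X) = - phi i X. Proof. exact: linearN. Qed.
Lemma phiZ i f X : phi i (f *: X) = f *: phi i X. Proof. exact: linearZ. Qed.
Definition linE := (etaD, etaN, etaZ, phiD, phiN, phiZ, metricE).

Hypothesis A3 : almost_3contact_metric phi xi eta g.

Lemma phi2 i X : phi i (phi i X) = - X + eta i X *: xi i.
Proof. by have [_ /(_ i) [+ _ _] _] := A3. Qed.
Lemma eta_xi i : eta i (xi i) = 1.
Proof. by have [_ /(_ i) [_ + _] _] := A3. Qed.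
Lemma metric_phi_phi i X Y : g (phi i X) (phi i Y) = g X Y - eta i X * eta i Y.
Proof. by have [_ /(_ i) [_ _ +] _] := A3. Qed.

(** Since [phi i] squared kills [xi i], computing its cube on [xi i] gives
    [phi i (xi i) = c *: xi i]; applying [phi i] once more gives [c * c = 0]. *)
Lemma phi_xi i : phi i (xi i) = 0.
Proof.
have p2 : phi i (phi i (xi i)) = 0 by rewrite phi2 eta_xi scale1r addNr.
have p1 : phi i (xi i) = eta i (phi i (xi i)) *: xi i.
  have := phi2 i (phi i (xi i)); rewrite p2 (_ : phi i 0 = 0); last exact: linear0.
  by move/eqP; rewrite eq_sym addrC subr_eq0 => /eqP.
have c2 : eta i (phi i (xi i)) = 0.
  apply: Cinf_sqr_eq0; rewrite -etaZ.
  have := p2; rewrite {1}p1 phiZ {2}p1 scalerA => /(congr1 (eta i)).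
  rewrite etaZ eta_xi mulr1 etaZ => ->; exact: linear0.
by rewrite p1 c2 scale0r.
Qed.

Lemma metric_xi i X : g X (xi i) = eta i X.
Proof.
have := metric_phi_phi i X (xi i); rewrite phi_xi eta_xi mulr1.
rewrite -(subrr X) metricDr metricNr subrr => /eqP; rewrite eq_sym subr_eq0 => /eqP //.
Qed.

Lemma xi_metric i X : g (xi i) X = eta i X. Proof. by rewrite metricC metric_xi. Qed.

(** Computing the cube of [phi i] in two ways leaves [eta i (phi i X) *: xi i = 0]. *)
Lemma eta_phi i X : eta i (phi i X) = 0.
Proof.
have := phi2 i (phi i X); rewrite [phi i (phi i X)](phi2 i X) phiD phiN phiZ phi_xi scaler0 addr0.
move/eqP; rewrite -subr_eq0 opprD addNKr oppr_eq0 => /eqP /(congr1 (eta i)).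
rewrite etaZ eta_xi mulr1 => ->; exact: linear0.
Qed.

Lemma phi_skew i X Y : g (phi i X) Y = - g X (phi i Y).
Proof.
have := metric_phi_phi i X (phi i Y); rewrite phi2 eta_phi mulr0 subr0 metricDr metricNr metricZr metric_xi.
by rewrite eta_phi mulr0 addr0 => <-; rewrite opprK.
Qed.

Lemma phi_antisym i X Y : g X (phi i Y) = - g Y (phi i X).
Proof. by rewrite -phi_skew metricC. Qed.

Section Triple.
Variables i j k : 'I_3.
Hypothesis ev : even_triple i j k.

Lemma even_triple_identities : [/\ forall X, phi i (phi j X) = phi k X + eta j X *: xi i,
  forall X, phi j (phi i X) = - phi k X + eta i X *: xi j,
  phi i (xi j) = xi k, phi j (xi i) = - xi k &
  forall X, eta i (phi j X) = eta k X /\ eta j (phi i X) = - eta k X].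
Proof.
have [_ _ /(_ _ _ _ ev) [h1 h2 [h3 h4] h5]] := A3.
split=> [X|X|||X].
- by rewrite h1 subrK.
- by rewrite h2 opprD opprK subrK.
- by rewrite h3.
- by rewrite h4 opprK.
- by have [e1 e2] := h5 X; rewrite -e1 e2 opprK.
Qed.

End Triple.

Section TripleTable.
Variables i j k : 'I_3.
Hypothesis ev : even_triple i j k.
Let ev1 := even_triple_rot ev.
Let ev2 := even_triple_rot ev1.

Lemma phi_phi_next X : phi i (phi j X) = phi k X + eta j X *: xi i.
Proof. by have [-> //] := even_triple_identities ev. Qed.
Lemma phi_phi_prev X : phi j (phi i X) = - phi k X + eta i X *: xi j.
Proof. by have [_ -> //] := even_triple_identities ev. Qed.
Lemma phi_xi_next : phi i (xi j) = xi k.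
Proof. by have [_ _ -> //] := even_triple_identities ev. Qed.
Lemma phi_xi_prev : phi j (xi i) = - xi k.
Proof. by have [_ _ _ -> //] := even_triple_identities ev. Qed.
Lemma eta_phi_next X : eta i (phi j X) = eta k X.
Proof. by have [_ _ _ _ /(_ X) [-> //]] := even_triple_identities ev. Qed.
Lemma eta_phi_prev X : eta j (phi i X) = - eta k X.
Proof. by have [_ _ _ _ /(_ X) [_ -> //]] := even_triple_identities ev. Qed.
Lemma eta_xi_next : eta k (xi j) = 0.
Proof. by rewrite -eta_phi_next phi_xi; exact: linear0. Qed.
Lemma eta_xi_prev : eta k (xi i) = 0.
Proof. by apply/eqP; rewrite -oppr_eq0 -eta_phi_prev phi_xi; apply/eqP; exact: linear0. Qed.

End TripleTable.

(** * The canonical connection: derivatives of the structure and vertical torsion *)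

Section Canonical.
Variables (alpha delta : R) (nabla : VF -> VF -> VF).
Hypothesis dE : forall i j k, even_triple i j k -> forall X Y,
  ext_d (eta i) X Y = (2 * alpha) *: fundamental_form g (phi i) X Y
        + (2 * (alpha - delta)) *: wedge (eta j) (eta k) X Y.
Hypothesis cN : canonical_connection phi eta g alpha delta nabla.
Local Notation a := (alpha%:A : C).
Local Notation d := (delta%:A : C).
(** The constant beta as a constant function, so that identities in [a], [d], [b] are computations
    in the ring of smooth functions. *)
Let b : C := 2 * (d - 2 * a).

Lemma nablaD X Y Z : nabla X (Y + Z) = nabla X Y + nabla X Z.
Proof. by have [[[_ + _] _] _ _] := cN; apply. Qed.
Lemma nablaZ X f Y : nabla X (f *: Y) = X f *: Y + f *: nabla X Y.
Proof. by have [[[_ _ +] _] _ _] := cN; apply. Qed.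
Lemma nabla0 X : nabla X 0 = 0.
Proof. by apply: (@addIr _ (nabla X 0)); rewrite -nablaD !add0r. Qed.
Lemma nablaN X Y : nabla X (- Y) = - nabla X Y.
Proof. by apply: (@addIr _ (nabla X Y)); rewrite -nablaD !addNr nabla0. Qed.
Lemma nabla_linl Y : linear (nabla^~ Y).
Proof. by have [[[+ _ _] _] _ _] := cN; apply. Qed.
Lemma nablaDl X Y Z : nabla (X + Y) Z = nabla X Z + nabla Y Z.
Proof. by have := nabla_linl Z 1 X Y; rewrite /= !scale1r. Qed.
Lemma nabla_metric X Y Z : X (g Y Z) = g (nabla X Y) Z + g Y (nabla X Z).
Proof. by have [[_ +] _ _] := cN; apply. Qed.

Lemma ev_nat n p : (n%:R : C) p = n%:R.
Proof. by elim: n => // n IH; rewrite !mulrS evD IH. Qed.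

Lemma betaE : (2 * (delta - 2 * alpha))%:A = b :> C.
Proof. by apply/Cinf_eqP => p; rewrite !(evE, ev_nat); ring. Qed.


Lemma vf_bM X f : X (b * f) = b * X f.
Proof. by rewrite -betaE !mulr_algl vfZ. Qed.

Lemma nabla_phi i j k : even_triple i j k -> forall X Z,
  nabla X (phi i Z) = phi i (nabla X Z) + (b * eta k X) *: phi j Z - (b * eta j X) *: phi k Z.
Proof.
move=> ev X Z; have [_ _ /(_ _ _ _ ev X Z)] := cN.
rewrite /nabla_endo -![(2 * _) *: eta _ _]mulr_algl betaE => /eqP.
by rewrite subr_eq => /eqP ->; rewrite addrC addrA.
Qed.

Lemma g_nabla_xi i X : g (nabla X (xi i)) (xi i) = 0.
Proof.
apply: (@Cinf_mulrn_eq0 _ 1); rewrite mulr2n.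
have := nabla_metric X (xi i) (xi i); rewrite metric_xi eta_xi.
rewrite [g (xi i) _]metricC => <-; have := vf_cst X 1; by rewrite scale1r.
Qed.

(** Differentiating [phi i (xi i) = 0] determines [phi i (nabla X (xi i))]. Applying [phi i] again
    recovers the derivative up to its component along [xi i], which is zero because [xi i] has unit
    length. *)
Lemma nabla_xi i j k : even_triple i j k -> forall X,
  nabla X (xi i) = (b * eta k X) *: xi j - (b * eta j X) *: xi k.
Proof.
move=> ev X; have ev1 := even_triple_rot ev; have ev2 := even_triple_rot ev1.
have := nabla_phi ev X (xi i); rewrite phi_xi nabla0.
rewrite (phi_xi_prev ev) (phi_xi_next ev2) => /(congr1 (phi i)).
rewrite !(phiD, phiN, phiZ) phi2 (phi_xi_next ev) (phi_xi_prev ev2).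
rewrite -metric_xi g_nabla_xi scale0r addr0 (_ : phi i 0 = 0); last exact: linear0.
move/eqP; rewrite eq_sym -addrA addrC subr_eq0 => /eqP <-.
by rewrite !scalerN opprK.
Qed.

Lemma act_eta i j k : even_triple i j k -> forall X Y,
  X (eta i Y) = eta i (nabla X Y) + b * (eta k X * eta j Y - eta j X * eta k Y).
Proof.
move=> ev X Y; rewrite -(metric_xi i Y) nabla_metric metric_xi (nabla_xi ev) !metricE !metric_xi.
by ring.
Qed.

Lemma act_Phi i j k : even_triple i j k -> forall X Y Z,
  X (g Y (phi i Z)) = g (nabla X Y) (phi i Z) + g Y (phi i (nabla X Z))
    + b * (eta k X * g Y (phi j Z) - eta j X * g Y (phi k Z)).
Proof.
move=> ev X Y Z; rewrite nabla_metric (nabla_phi ev) !metricE; ring.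
Qed.

Lemma d_etaE i j k : even_triple i j k -> forall X Y,
  X (eta i Y) - Y (eta i X) - eta i (bracket X Y) = 
  2 * a * g X (phi i Y) + 2 * (a - d) * (eta j X * eta k Y - eta j Y * eta k X).
Proof.
move=> ev X Y; rewrite -[LHS]/(ext_d (eta i) X Y) (dE ev) /fundamental_form /wedge.
by apply/Cinf_eqP => p; rewrite !(evE, ev_nat); ring.
Qed.

Lemma eta_bracket i j k : even_triple i j k -> forall X Y,
  eta i (bracket X Y) = X (eta i Y) - Y (eta i X) -
    (2 * a * g X (phi i Y) + 2 * (a - d) * (eta j X * eta k Y - eta j Y * eta k X)).
Proof. by move=> ev X Y; rewrite -(d_etaE ev); ring. Qed.

(** This is [d eta_i] corrected by the derivative of [xi i]; the coefficient [2 * d - 6 * a] is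
    [2 * (a - d) + 2 * b]. *)
Lemma eta_torsion i j k : even_triple i j k -> forall X Y,
  eta i (torsion nabla X Y) =
  2 * a * g X (phi i Y) + (2 * d - 6 * a) * (eta j X * eta k Y - eta j Y * eta k X).
Proof.
move=> ev X Y; rewrite /torsion !(etaD, etaN) (eta_bracket ev) !(act_eta ev) /b.
by ring.
Qed.

Local Notation T := (torsion nabla).

Lemma torsion_form : three_form (fun X Y Z => g (T X Y) Z).
Proof. by have [_ + _] := cN. Qed.

Lemma torsionC X Y : T Y X = - T X Y.
Proof.
apply: vfieldP => f.
change ((nabla Y X f - nabla X Y f) - (Y (X f) - X (Y f)) =
  - ((nabla X Y f - nabla Y X f) - (X (Y f) - Y (X f)))).
by ring.
Qed.

Lemma torsion_alt X Y : g (T X Y) Y = 0.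
Proof. by have [_ _ _ /(_ Y X) []] := torsion_form. Qed.

Lemma torsion_swap X Y Z : g (T X Y) Z = - g (T X Z) Y.
Proof.
have [_ l2 _ _] := torsion_form.
have := torsion_alt X (Y + Z); rewrite metricDr => /eqP; rewrite addr_eq0.
have -> : g (T X (Y + Z)) Y = g (T X Z) Y.
  by have := l2 X Y 1 Y Z; rewrite /= scale1r mul1r torsion_alt add0r.
have -> : g (T X (Y + Z)) Z = g (T X Y) Z.
  by have := l2 X Z 1 Y Z; rewrite /= scale1r mul1r torsion_alt addr0.
by move/eqP => ->; rewrite opprK.
Qed.

Lemma torsion_cycle X Y Z : g (T X Y) Z = g (T Y Z) X.
Proof. by rewrite torsionC metricNl torsion_swap opprK. Qed.

Lemma torsionDl X Y Z : T (X + Y) Z = T X Z + T Y Z.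
Proof.
apply: metric_inj => W; have [l1 _ _ _] := torsion_form.
by have := l1 Z W 1 X Y; rewrite /= scale1r mul1r metricDl.
Qed.
Lemma torsionDr X Y Z : T X (Y + Z) = T X Y + T X Z.
Proof. by rewrite torsionC torsionDl opprD -!torsionC. Qed.
Lemma torsionNr X Y : T X (- Y) = - T X Y.
Proof.
apply: metric_inj => W; have [_ l2 _ _] := torsion_form.
have := l2 X W (-1) Y 0; rewrite /= addr0 scaleN1r mulN1r metricNl => ->.
have := l2 X W 0 Y 0; rewrite /= scale0r mul0r !add0r => e.
have := l2 X W 1 0 0; rewrite /= scaler0 addr0 mul1r => /eqP.
by rewrite -subr_eq0 opprD addNKr oppr_eq0 => /eqP ->; rewrite addr0.
Qed.
Lemma torsionNl X Y : T (- X) Y = - T X Y.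
Proof. by rewrite torsionC torsionNr -torsionC. Qed.

Hypothesis alpha0 : alpha != 0.

(** Here [alpha != 0] enters the torsion: [d (d eta_i) = 0] constrains the fundamental form only
    after division by [2 * alpha]. *)
Lemma two_alpha_reg f : 2 * a * f = 0 -> f = 0.
Proof.
move=> /Cinf_eqP f0; apply/Cinf_eqP => p; have := f0 p.
rewrite !(evE, ev_nat) mulr1 => /eqP; rewrite !mulf_eq0 pnatr_eq0 (negPf alpha0) /=.
by move/eqP.
Qed.

Lemma vf_two_alphaM X f : X (2 * a * f) = 2 * a * X f.
Proof.
have -> : 2 * a = (2 * alpha)%:A :> C by apply/Cinf_eqP => p; rewrite !(evE, ev_nat); ring.
by rewrite !mulr_algl vfZ.
Qed.

Lemma jacobi X Y Z :
  bracket (bracket X Y) Z + bracket (bracket Y Z) X + bracket (bracket Z X) Y = 0.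
Proof.
apply: vfieldP => f.
change (((X (Y (Z f)) - Y (X (Z f))) - Z (X (Y f) - Y (X f))) +
  ((Y (Z (X f)) - Z (Y (X f))) - X (Y (Z f) - Z (Y f))) +
  ((Z (X (Y f)) - X (Z (Y f))) - Y (Z (X f) - X (Z f))) = 0).
by rewrite !vfB; ring.
Qed.

(** * Vanishing of the horizontal torsion *)

Section HorizontalTorsion.
Variables i j k : 'I_3.
Hypothesis ev : even_triple i j k.
Let ev1 := even_triple_rot ev.
Let ev2 := even_triple_rot ev1.

Definition horizontal X := [/\ eta i X = 0, eta j X = 0 & eta k X = 0].

Lemma horizontal_phi X : horizontal X -> horizontal (phi i X).
Proof.
move=> [Xi Xj Xk]; split; first exact: eta_phi.
  by rewrite (eta_phi_prev ev) Xk oppr0.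
by rewrite (eta_phi_next ev2).
Qed.

Lemma horizontal_phi2 X : horizontal X -> phi i (phi i X) = - X.
Proof. by move=> [Xi _ _]; rewrite phi2 Xi scale0r addr0. Qed.

(* The horizontal part of [d (d eta_i) = 0]. *)
Lemma horizontal_dPhi X Y Z : horizontal X -> horizontal Y -> horizontal Z ->
  g (T X Y) (phi i Z) + g (T Y Z) (phi i X) + g (T Z X) (phi i Y) = 0.
Proof.
move=> [Xi Xj Xk] [Yi Yj Yk] [Zi Zj Zk].
(* In the cyclic sum of these identities the [nabla] terms cancel in pairs, leaving the torsion, and
   the right-hand sides add up to zero by Jacobi. *)
have key U V W : horizontal U -> horizontal V -> horizontal W ->
    2 * a * (g (nabla W U) (phi i V) - g (nabla W V) (phi i U) - g (nabla U V) (phi i W)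
      + g (nabla V U) (phi i W) + g (T U V) (phi i W)) = eta i (bracket (bracket U V) W).
  move=> [Ui Uj Uk] [Vi Vj Vk] [Wi Wj Wk].
  have e1 := d_etaE ev (bracket U V) W; have e2 := congr1 W (d_etaE ev U V).
  move: e1 e2; rewrite Ui Vi Wi Wj Wk Vj Vk !vf0 !mul0r !mulr0 !subr0 !mulr0 !addr0 !sub0r.
  rewrite vf_two_alphaM vfN (act_Phi ev) Wj Wk (phi_antisym i U) => e1 e2.
  have -> : g (T U V) (phi i W) =
      g (nabla U V) (phi i W) - g (nabla V U) (phi i W) - g (bracket U V) (phi i W).
    by rewrite /torsion !metricE.
  have -> : eta i (bracket (bracket U V) W) =
      - W (eta i (bracket U V)) - 2 * a * g (bracket U V) (phi i W).
    by rewrite -e1; ring.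
  by rewrite e2; ring.
have hX : horizontal X by []. have hY : horizontal Y by []. have hZ : horizontal Z by [].
have := congr1 (eta i) (jacobi X Y Z); rewrite !etaD (_ : eta i 0 = 0); last exact: linear0.
move=> J; apply: two_alpha_reg; rewrite -J -!key//.
by ring.
Qed.

(* [horizontal_dPhi] says that the derivation of forms induced by [phi i] kills
   the torsion; on forms of type (p, q) it acts as i(p - q), which is nonzero in
   odd degree. *)
Lemma torsion_horizontal X Y Z : horizontal X -> horizontal Y -> horizontal Z ->
  g (T X Y) Z = 0.
Proof.
move=> hX hY hZ; have [pX pY pZ] := And3 (horizontal_phi hX) (horizontal_phi hY) (horizontal_phi hZ).
have e0 := horizontal_dPhi pX pY pZ.
(* The identity with [phi i W] in place of [W]. Its three cyclic instances express three times the
   torsion as twice a sum that [e0] makes zero. *)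
have step U V W : horizontal U -> horizontal V -> horizontal W ->
    g (T U V) W = g (T (phi i W) (phi i U)) V + g (T (phi i V) (phi i W)) U.
  move=> hU hV hW; have := horizontal_dPhi hU hV (horizontal_phi hW).
  rewrite (horizontal_phi2 hW) metricNr [g (T V _) _]torsion_cycle.
  rewrite [g (T (phi i W) U) _]torsion_cycle [g (T U (phi i V)) _]torsion_cycle => e.
  by rewrite -[LHS]addr0 -e; ring.
have s1 := step X Y Z hX hY hZ; have s2 := step Y Z X hY hZ hX.
have s3 := step Z X Y hZ hX hY.
move: e0; rewrite !horizontal_phi2// !metricNr => e0.
apply: (@Cinf_mulrn_eq0 _ 2).
have -> : g (T X Y) Z *+ 3 = g (T X Y) Z + g (T Y Z) X + g (T Z X) Y.
  by rewrite -[g (T Y Z) X]torsion_cycle [g (T Z X) Y]torsion_cycle; ring.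
rewrite s1 s2 s3.
transitivity (- 2 * (- g (T (phi i X) (phi i Y)) Z - g (T (phi i Y) (phi i Z)) X
  - g (T (phi i Z) (phi i X)) Y)); first ring.
by rewrite e0 mulr0.
Qed.

End HorizontalTorsion.

(* [tau] is [2 alpha \sum_i eta_i /\ Phi_i + 2 (delta - alpha) eta_1 /\ eta_2 /\ eta_3]. *)
Definition tau i j k X Y Z : C :=
  2 * a * (eta i X * g Y (phi i Z) + eta i Y * g Z (phi i X) + eta i Z * g X (phi i Y)
    + (eta j X * g Y (phi j Z) + eta j Y * g Z (phi j X) + eta j Z * g X (phi j Y))
    + (eta k X * g Y (phi k Z) + eta k Y * g Z (phi k X) + eta k Z * g X (phi k Y)))
  + 2 * (d - a) * (eta i X * (eta j Y * eta k Z - eta k Y * eta j Z)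
    + eta j X * (eta k Y * eta i Z - eta i Y * eta k Z)
    + eta k X * (eta i Y * eta j Z - eta j Y * eta i Z)).

Lemma tau_rot i j k X Y Z : tau i j k X Y Z = tau j k i X Y Z.
Proof. by rewrite /tau; ring. Qed.

Lemma tau_cycle i j k X Y Z : tau i j k X Y Z = tau i j k Y Z X.
Proof. by rewrite /tau; ring. Qed.

Lemma tau_xi i j k X Y : even_triple i j k -> tau i j k X Y (xi i) = g (T X Y) (xi i).
Proof.
move=> ev; have ev1 := even_triple_rot ev; have ev2 := even_triple_rot ev1.
rewrite metric_xi (eta_torsion ev) /tau phi_xi (phi_xi_prev ev) (phi_xi_next ev2) metricNr.
rewrite eta_xi (eta_xi_next ev2) (eta_xi_prev ev) !xi_metric !metric_xi.
by rewrite metric0r eta_phi (eta_phi_next ev) (eta_phi_prev ev2); ring.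
Qed.

(** * The torsion as an explicit parallel three-form *)

Section TorsionFormula.
Variables i j k : 'I_3.
Hypothesis ev : even_triple i j k.
Let ev1 := even_triple_rot ev.
Let ev2 := even_triple_rot ev1.

Definition hpart X := X - eta i X *: xi i - eta j X *: xi j - eta k X *: xi k.

Lemma hpart_horizontal X : horizontal i j k (hpart X).
Proof.
split; rewrite /hpart !linE !eta_xi.
- by rewrite (eta_xi_prev ev1) (eta_xi_next ev1); ring.
- by rewrite (eta_xi_next ev2) (eta_xi_prev ev2); ring.
- by rewrite (eta_xi_next ev) (eta_xi_prev ev); ring.
Qed.

(** Both forms agree when the last argument is one of the [xi], so their difference sees only its
    horizontal part. *)
Lemma tau_hpart X Y Z :
  g (T X Y) Z - tau i j k X Y Z = g (T X Y) (hpart Z) - tau i j k X Y (hpart Z).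
Proof.
have tD U V : tau i j k X Y (U + V) = tau i j k X Y U + tau i j k X Y V.
  by rewrite /tau !linE; ring.
have tN U : tau i j k X Y (- U) = - tau i j k X Y U by rewrite /tau !linE; ring.
have tZ f U : tau i j k X Y (f *: U) = f * tau i j k X Y U by rewrite /tau !linE; ring.
rewrite /hpart !(tD, tN, tZ, metricDr, metricNr, metricZr) (tau_xi _ _ ev).
have tj : tau i j k X Y (xi j) = g (T X Y) (xi j) by rewrite tau_rot (tau_xi _ _ ev1).
have tk : tau i j k X Y (xi k) = g (T X Y) (xi k) by rewrite -(tau_rot k) (tau_xi _ _ ev2).
by rewrite tj tk; ring.
Qed.

(** The difference of the two forms is cyclic, so each argument in turn is replaced by its
    horizontal part, and there both forms vanish. *)
Lemma torsion_formula X Y Z : g (T X Y) Z = tau i j k X Y Z.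
Proof.
pose u X Y Z := g (T X Y) Z - tau i j k X Y Z.
have uc U V W : u U V W = u V W U by rewrite /u torsion_cycle tau_cycle.
have uh U V W : u U V W = u U V (hpart W) by exact: tau_hpart.
apply/eqP; rewrite -subr_eq0 -/(u X Y Z) uh uc uh uc uh.
have [[Xi Xj Xk] [Yi Yj Yk] [Zi Zj Zk]] :=
  And3 (hpart_horizontal X) (hpart_horizontal Y) (hpart_horizontal Z).
rewrite /u (torsion_horizontal ev)//; try exact: hpart_horizontal.
by rewrite /tau Xi Xj Xk Yi Yj Yk Zi Zj Zk; apply/eqP; ring.
Qed.

(** [tau] is invariant under simultaneous rotation of the [eta] and the [phi]; their covariant
    derivatives are infinitesimal rotations, so the extra terms cancel. *)
Lemma act_tau X Y Z W : X (tau i j k Y Z W) =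
  tau i j k (nabla X Y) Z W + tau i j k Y (nabla X Z) W + tau i j k Y Z (nabla X W).
Proof.
have X2a f : X (2 * a * f) = 2 * a * X f by exact: vf_two_alphaM.
have X2da f : X (2 * (d - a) * f) = 2 * (d - a) * X f.
  have -> : 2 * (d - a) = (2 * (delta - alpha))%:A :> C.
    by apply/Cinf_eqP => p; rewrite !(evE, ev_nat); ring.
  by rewrite !mulr_algl vfZ.
rewrite /tau vfD X2a X2da !(vfD, vfN, vf_leibniz).
rewrite !(act_Phi ev, act_Phi ev1, act_Phi ev2, act_eta ev, act_eta ev1, act_eta ev2).
rewrite ![g _ (phi _ (nabla X _))]phi_antisym.
ring.
Qed.

End TorsionFormula.

(** * The curvature as a tensor *)

Local Notation Rc := (curvature nabla).

Lemma vf_evD X Y f : (X + Y) f = X f + Y f. Proof. by []. Qed.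
Lemma vf_evN X f : (- X) f = - X f. Proof. by []. Qed.
Lemma vf_evZ X h f : (h *: X) f = h * X f. Proof. by []. Qed.
Definition vf_evE := (vf_evD, vf_evN, vf_evZ).

Lemma nablaNl X Y : nabla (- X) Y = - nabla X Y.
Proof.
have e := nabla_linl Y (-1) X 0; rewrite /= !scaleN1r addr0 in e.
have e0 := nabla_linl Y 1 0 0; rewrite /= !scale1r addr0 in e0.
by rewrite e; have /eqP := e0; rewrite -subr_eq0 opprD addNKr oppr_eq0 => /eqP ->; rewrite addr0.
Qed.
Lemma nablaZl f X Y : nabla (f *: X) Y = f *: nabla X Y.
Proof.
have e := nabla_linl Y f X 0; rewrite /= addr0 in e.
have e0 := nabla_linl Y 1 0 0; rewrite /= !scale1r addr0 in e0.
by rewrite e; have /eqP := e0; rewrite -subr_eq0 opprD addNKr oppr_eq0 => /eqP ->; rewrite addr0.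
Qed.

Lemma bracketC X Y : bracket Y X = - bracket X Y.
Proof.
apply: vfieldP => f; change (Y (X f) - X (Y f) = - (X (Y f) - Y (X f))); by ring.
Qed.

Lemma curvatureC X Y Z : Rc Y X Z = - Rc X Y Z.
Proof.
rewrite /curvature bracketC nablaNl; apply: vfieldP => f; rewrite !vf_evE; ring.
Qed.

Lemma curvature_linl Y Z : linear (fun X => Rc X Y Z).
Proof.
move=> f X1 X2 /=.
rewrite /curvature.
have -> : bracket (f *: X1 + X2) Y = f *: bracket X1 Y - Y f *: X1 + bracket X2 Y.
  apply: vfieldP => h; change ((f * X1 (Y h) + X2 (Y h)) - Y (f * X1 h + X2 h) =
    f * (X1 (Y h) - Y (X1 h)) - Y f * X1 h + (X2 (Y h) - Y (X2 h))).
  by rewrite vfD vf_leibniz; ring.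
rewrite !(nablaDl, nablaNl, nablaZl, nablaD, nablaZ).
by apply: vfieldP => h; rewrite !vf_evE; ring.
Qed.

Lemma curvature_linr X Y : linear (Rc X Y).
Proof.
move=> f Z1 Z2; rewrite /curvature !(nablaD, nablaZ).
by apply: vfieldP => h; rewrite !vf_evE /=; ring.
Qed.

Lemma curvature_skew X Y Z W : g (Rc X Y Z) W = - g Z (Rc X Y W).
Proof.
have e : bracket X Y (g Z W) = X (Y (g Z W)) - Y (X (g Z W)) by [].
rewrite /curvature !metricE.
have -> : g (nabla (bracket X Y) Z) W =
    X (Y (g Z W)) - Y (X (g Z W)) - g Z (nabla (bracket X Y) W).
  by rewrite -e nabla_metric; ring.
by rewrite !nabla_metric !vfD !nabla_metric; ring.
Qed.

(* [Rc X Y] acts on [phi i], [phi j], [phi k] and on [xi i], [xi j], [xi k] as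
   the infinitesimal rotation with these coefficients. *)
Definition rotation_form l l1 l2 X Y : C :=
  2 * a * b * (g X (phi l Y) - (eta l1 X * eta l2 Y - eta l1 Y * eta l2 X)).

Lemma rotation_form_scalar l l1 l2 Y : scalar (fun X => rotation_form l l1 l2 X Y).
Proof. by move=> f X Z; rewrite /rotation_form !linE; ring. Qed.

(** * Bianchi identity, pair symmetry and commutators with the structure *)

Section Bianchi.
Variables i j k : 'I_3.
Hypothesis ev : even_triple i j k.
Let ev1 := even_triple_rot ev.
Let ev2 := even_triple_rot ev1.

Lemma nabla_torsion X Y Z : nabla X (T Y Z) = T (nabla X Y) Z + T Y (nabla X Z).
Proof.
apply: metric_inj => W; rewrite [RHS]metricDl.
have e := nabla_metric X (T Y Z) W.
have -> : g (nabla X (T Y Z)) W = X (g (T Y Z) W) - g (T Y Z) (nabla X W) by rewrite e; ring.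
by rewrite !(torsion_formula ev) (act_tau ev); ring.
Qed.

Lemma bianchi X Y Z : Rc X Y Z + Rc Y Z X + Rc Z X Y =
  T (T X Y) Z + T (T Y Z) X + T (T Z X) Y.
Proof.
have nT U V : nabla U V = nabla V U + bracket U V + T U V.
  by rewrite /torsion; apply: vfieldP => h; rewrite !vf_evE; ring.
(* Exchanging [V] and [W] creates a bracket and a torsion term, the latter differentiated as a
   parallel tensor. After the cyclic sum the second derivatives cancel and the double brackets
   vanish by Jacobi. *)
have A U V W : nabla U (nabla V W) =
    nabla U (nabla W V) + (nabla (bracket V W) U + bracket U (bracket V W) +
    (T U (nabla V W) - T U (nabla W V) - T U (T V W))) + (T (nabla U V) W + T V (nabla U W)).
  have -> : nabla U (nabla V W) = nabla U (nabla W V + bracket V W + T V W) by rewrite -nT.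
  rewrite (nablaD U (nabla W V + bracket V W) (T V W)) (nablaD U (nabla W V)) nabla_torsion.
  rewrite (nT U (bracket V W)).
  congr (_ + (_ + _ + _) + _).
  have -> : bracket V W = nabla V W - nabla W V - T V W.
    by rewrite /torsion; apply: vfieldP => h; rewrite !vf_evE; ring.
  by rewrite (torsionDr U (nabla V W - nabla W V)) (torsionDr U (nabla V W)) !torsionNr.
rewrite /curvature (A X Y Z) (A Y Z X) (A Z X Y).
rewrite ![T (nabla _ _) _]torsionC ![T (T _ _) _]torsionC.
move: T => t; apply: vfieldP => h.
have : (bracket (bracket X Y) Z + bracket (bracket Y Z) X + bracket (bracket Z X) Y) h = 0.
  by rewrite jacobi.
rewrite [bracket (bracket X Y) Z]bracketC [bracket (bracket Y Z) X]bracketC.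
rewrite [bracket (bracket Z X) Y]bracketC !vf_evE => J.
by rewrite -[LHS]addr0 -[X in _ + X]J; ring.
Qed.

Definition rtens X Y Z W := g (Rc X Y Z) W.

(** The torsion side of the Bianchi identity paired with [W]; as [T] is a three-form, this is
    alternating in all four arguments. *)
Definition sigma X Y Z W := g (T X Y) (T Z W) + g (T Y Z) (T X W) + g (T Z X) (T Y W).

Lemma bianchi_rtens X Y Z W : rtens X Y Z W + rtens Y Z X W + rtens Z X Y W = sigma X Y Z W.
Proof.
rewrite /rtens -!metricDl bianchi 2!metricDl.
rewrite [g (T (T X Y) Z) W]torsion_cycle [g (T Z W) _]metricC.
rewrite [g (T (T Y Z) X) W]torsion_cycle [g (T X W) _]metricC.
by rewrite [g (T (T Z X) Y) W]torsion_cycle [g (T Y W) _]metricC.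
Qed.

Lemma rtens_skew12 X Y Z W : rtens X Y Z W = - rtens Y X Z W.
Proof. by rewrite /rtens (curvatureC Y X) metricNl. Qed.

Lemma rtens_skew34 X Y Z W : rtens X Y Z W = - rtens X Y W Z.
Proof. by rewrite /rtens curvature_skew metricC. Qed.

(** As in the torsion-free case, four Bianchi sums with signs [+ + - -] give twice the difference;
    their right-hand sides do not vanish here but cancel because [sigma] is alternating. *)
Lemma rtens_pair X Y Z W : rtens X Y Z W = rtens Z W X Y.
Proof.
apply/eqP; rewrite -subr_eq0; apply/eqP; apply: (@Cinf_mulrn_eq0 _ 1).
have c1 := rtens_skew12; have c2 := rtens_skew34.
transitivity ((rtens X Y Z W + rtens Y Z X W + rtens Z X Y W)
  + (rtens Y Z W X + rtens Z W Y X + rtens W Y Z X)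
  - (rtens Z W X Y + rtens W X Z Y + rtens X Z W Y)
  - (rtens W X Y Z + rtens X Y W Z + rtens Y W X Z)).
  rewrite (c2 Y Z W X) (c2 Z W Y X) (c1 W Y Z X) (c1 W X Z Y) (c2 X W Z Y) (c1 X Z W Y).
  by rewrite (c2 Z X W Y) (c1 W X Y Z) (c2 X Y W Z) (c2 Y W X Z); ring.
rewrite !bianchi_rtens /sigma (torsionC X W) (torsionC Y W) (torsionC Z X).
rewrite (torsionC X Y) (torsionC Y Z) (torsionC Z W) !metricNl !metricNr.
rewrite (metricC (T Z W) (T X Y)) (metricC (T Y W)) (metricC (T X W)).
ring.
Qed.

(** The derivative of [b * eta k] gives the fundamental form and a wedge term with factor
    [2 * (a - d)]; the quadratic terms add [b] to that factor, which becomes [- 2 * a]. *)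
Lemma curvature_phi X Y Z : Rc X Y (phi i Z) = phi i (Rc X Y Z)
  + rotation_form k i j X Y *: phi j Z
  - rotation_form j k i X Y *: phi k Z.
Proof.
apply: metric_inj => W; rewrite /curvature.
rewrite !(nabla_phi ev, nablaD, nablaN, nablaZ, phiD, phiN, phiZ, nabla_phi ev1, nabla_phi ev2).
rewrite !metricE !vf_bM.
rewrite (eta_bracket ev2) (eta_bracket ev1) /rotation_form /b; ring.
Qed.

Lemma curvature_xi X Y : Rc X Y (xi i) =
    rotation_form k i j X Y *: xi j
  - rotation_form j k i X Y *: xi k.
Proof.
apply: metric_inj => W; rewrite /curvature.
rewrite !(nabla_xi ev, nablaD, nablaN, nablaZ, nabla_xi ev1, nabla_xi ev2).
rewrite !metricE !vf_bM.
rewrite (eta_bracket ev2) (eta_bracket ev1) /rotation_form /b; ring.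
Qed.

End Bianchi.

(** * Traces over a frame orthonormal at a point *)

Section Traces.
Variables (p : M) (e : 'I_m -> VF).
Hypothesis oe : orthonormal_at g p e.

Definition frame_tr (f : VF -> C) : R := \sum_l f (e l) p.

Lemma tr_ext (f h : VF -> C) : (forall U, f U = h U) -> frame_tr f = frame_tr h.
Proof. by move=> fh; apply: eq_bigr => l _; rewrite fh. Qed.
Lemma trD (f h : VF -> C) : frame_tr (fun U => f U + h U) = frame_tr f + frame_tr h.
Proof. by rewrite /frame_tr -big_split. Qed.
Lemma trN (f : VF -> C) : frame_tr (fun U => - f U) = - frame_tr f.
Proof. by rewrite /frame_tr -sumrN. Qed.
Lemma trM c (f : VF -> C) : frame_tr (fun U => c * f U) = c p * frame_tr f.
Proof. by rewrite /frame_tr mulr_sumr. Qed.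
Lemma tr_dual X (t : VF -> C) : scalar t -> frame_tr (fun U => g U X * t U) = t X p.
Proof. by move=> ts; rewrite (parseval X gR oe ts). Qed.
Lemma tr_eta i (t : VF -> C) : scalar t -> frame_tr (fun U => eta i U * t U) = t (xi i) p.
Proof. by move=> ts; rewrite -tr_dual//; apply: tr_ext => U; rewrite metric_xi. Qed.
Lemma tr_g : frame_tr (fun U => g U U) = m%:R.
Proof.
rewrite /frame_tr (eq_bigr (fun=> 1)); first by rewrite sumr_const card_ord.
by move=> l _; rewrite oe eqxx.
Qed.
Lemma g_phi_self i X : g X (phi i X) = 0.
Proof.
apply: (@Cinf_mulrn_eq0 _ 1); rewrite mulr2n.
by have := phi_antisym i X X => {1}->; rewrite addNr.
Qed.
Lemma tr_g_phi i : frame_tr (fun U => g U (phi i U)) = 0.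
Proof. by rewrite /frame_tr big1// => l _; rewrite g_phi_self. Qed.

(** Expanding [phi i (e l)] in the frame turns both sides into double sums whose matrices are
    opposite transposes. *)
Lemma tr_skew i (B : VF -> VF -> C) :
  (forall V, scalar (B^~ V)) -> (forall U, scalar (B U)) ->
  frame_tr (fun U => B (phi i U) U) = - frame_tr (fun U => B U (phi i U)).
Proof.
move=> B1 B2; rewrite /frame_tr.
under eq_bigr => l _ do rewrite (parseval (phi i (e l)) gR oe (B1 (e l))).
rewrite exchange_big -sumrN; apply: eq_bigr => l _ /=.
rewrite (parseval (phi i (e l)) gR oe (B2 (e l))) -sumrN; apply: eq_bigr => l' _.
by rewrite [g (e l) _]phi_antisym evN mulNr.
Qed.

Lemma eta_scalar i : scalar (eta i).
Proof. by move=> f X Y; rewrite etaD etaZ. Qed.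
Lemma g_phi_scalar i X : scalar (fun U => g X (phi i U)).
Proof. by move=> f U V; rewrite phiD phiZ metricDr metricZr. Qed.
Lemma rtens_scalar1 X Y W : scalar (fun U => rtens U X Y W).
Proof. by move=> f U V; rewrite /rtens (curvature_linl X Y f U V) metricDl metricZl. Qed.
Lemma rtens_scalar3 X Y W : scalar (fun U => rtens X Y U W).
Proof. by move=> f U V; rewrite /rtens (curvature_linr X Y f U V) metricDl metricZl. Qed.

Definition ric X Y := frame_tr (fun U => rtens U X Y U).

(** * Traces of curvature and torsion against the structure tensors *)

Section TraceFormulas.
Variables i j k : 'I_3.
Hypothesis ev : even_triple i j k.
Let ev1 := even_triple_rot ev.
Let ev2 := even_triple_rot ev1.

Lemma ricC X Y : ric X Y = ric Y X.
Proof.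
apply: tr_ext => U; rewrite (rtens_pair ev) rtens_skew12 rtens_skew34; exact: opprK.
Qed.

(** [curvature_xi] reduces the trace to rotation forms evaluated at [xi j] and [xi k], each
    contributing [4 * a * b * eta i X]. *)
Lemma ric_xi X : ric X (xi i) = (8 * a * b * eta i X) p.
Proof.
pose F l l1 l2 U := rotation_form l l1 l2 U X.
have Fs l l1 l2 : scalar (F l l1 l2) by exact: rotation_form_scalar.
transitivity (frame_tr (fun U => eta j U * F k i j U) - frame_tr (fun U => eta k U * F j k i U)).
  rewrite -trN -trD; apply: tr_ext => U.
  by rewrite /rtens (curvature_xi ev) !metricE !xi_metric /F; ring.
rewrite !tr_eta// -evN -evD; congr (fun_of_Cinf _ p).
rewrite /F /rotation_form !xi_metric (eta_phi_next ev1) (eta_phi_prev ev1) !eta_xi.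
rewrite (eta_xi_prev ev1) (eta_xi_next ev1).
ring.
Qed.

(* Write [phi i = phi j \o phi k - eta k *: xi j] and move [phi j] across the
   trace: the trace reappears with the opposite sign, up to the commutator of
   [Rc X Y] with [phi j]. *)
Lemma tr_rtens_phi X Y : 2 * frame_tr (fun U => rtens X Y U (phi i U)) =
  m.+1%:R * rotation_form i j k X Y p.
Proof.
set F := rotation_form i j k X Y; pose Fk := rotation_form k i j X Y.
pose r U V := rtens X Y U V.
have rs V : scalar (r^~ V) by exact: rtens_scalar3.
have e1 : frame_tr (fun U => r U (phi i U)) =
    frame_tr (fun U => r U (phi j (phi k U))) - r (xi k) (xi j) p.
  rewrite -(tr_eta k (rs (xi j))) -trN -trD; apply: tr_ext => U.
  by rewrite (phi_phi_next ev1) /r /rtens metricDr metricZr; ring.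
have e2 : frame_tr (fun U => r U (phi j (phi k U))) = - frame_tr (fun U => r (phi j U) (phi k U))
    + (F p * frame_tr (fun U => g (phi k U) (phi k U))
      - Fk p * frame_tr (fun U => g (phi i U) (phi k U))).
  rewrite -!trM -!trN -!trD; apply: tr_ext => U.
  rewrite /r /rtens (curvature_phi ev1) -/F -/Fk; move: (Rc X Y U) => V.
  by rewrite (phi_antisym j V) !(metricDl, metricNl, metricZl) [g (phi j V) _]metricC; ring.
have e3 : - frame_tr (fun U => r (phi j U) (phi k U)) =
    - frame_tr (fun U => r U (phi i U)) + r (xi j) (xi k) p.
  rewrite (@tr_skew j (fun U V => r U (phi k V)))//; last first.
    by move=> U f V W; rewrite /r /rtens phiD phiZ metricDr metricZr.
  rewrite opprK -(tr_eta j (rs (xi k))) -trN -trD; apply: tr_ext => U.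
  by rewrite (phi_phi_prev ev1) /r /rtens !metricDr metricNr metricZr; ring.
(* [phi k] is isometric on the complement of [xi k], hence [m - 1]; the vertical corrections [e6]
   and [e7] raise the total to [m.+1]. *)
have e4 : frame_tr (fun U => g (phi k U) (phi k U)) = m%:R - 1.
  transitivity (frame_tr (fun U => g U U) - frame_tr (fun U => eta k U * eta k U)).
    by rewrite -trN -trD; apply: tr_ext => U; exact: metric_phi_phi.
  by rewrite tr_g (tr_eta k (eta_scalar k)) eta_xi.
have e5 : frame_tr (fun U => g (phi i U) (phi k U)) = 0.
  transitivity (frame_tr (fun U => g U (phi j U)) - frame_tr (fun U => eta k U * eta i U)).
    rewrite -trN -trD; apply: tr_ext => U.
    by rewrite phi_skew (phi_phi_prev ev2) !metricE metric_xi; ring.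
  by rewrite tr_g_phi (tr_eta k (eta_scalar i)) (eta_xi_next ev1) subr0.
have e6 : r (xi j) (xi k) = F.
  by rewrite /r /rtens (curvature_xi ev1) !metricE !xi_metric eta_xi (eta_xi_next ev1) /F; ring.
have e7 : r (xi k) (xi j) = - F by rewrite /r rtens_skew34 -/(r _ _) e6.
have e8 := e1; rewrite e2 e3 e4 e5 e6 e7 evN in e8.
rewrite mulr2n mulrDl !mul1r {2}e8 -addn1 natrD; ring.
Qed.

(** By skewness [phi i] passes from the last slot through the curvature to [Y]; each of the two
    commutator terms contributes [2 * a * b * g X (phi i Y)]. *)
Lemma tr_rtens_phi_mid X Y : horizontal i j k X -> horizontal i j k Y ->
  frame_tr (fun U => rtens U X Y (phi i U)) = - ric X (phi i Y) + (4 * a * b * g X (phi i Y)) p.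
Proof.
move=> [Xi Xj Xk] [Yi Yj Yk].
pose F l l1 l2 U := rotation_form l l1 l2 U X.
have Fs l l1 l2 : scalar (F l l1 l2) by exact: rotation_form_scalar.
transitivity (- ric X (phi i Y) + (frame_tr (fun U => g U (phi j Y) * F k i j U)
    - frame_tr (fun U => g U (phi k Y) * F j k i U))).
  rewrite /ric -!trN -!trD; apply: tr_ext => U.
  rewrite /rtens (curvature_phi ev) -/(F k i j U) -/(F j k i U).
  move: (Rc U X Y) => V.
  rewrite (phi_antisym i V) !(metricDl, metricNl, metricZl) [g (phi i V) _]metricC.
  by rewrite [g (phi j Y) U]metricC [g (phi k Y) U]metricC; ring.
rewrite !tr_dual// -evN -evD; congr (_ + fun_of_Cinf _ p).
rewrite /F /rotation_form Xi Xj Xk !phi_skew (phi_phi_next ev1) (phi_phi_prev ev1) !metricE Xj Xk !metric_xi.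
by rewrite (phi_antisym i X) Yj Yk; ring.
Qed.

Lemma torsion_hor X U : horizontal i j k X -> T X U = (2 * a) *: 
  (eta i U *: phi i X + eta j U *: phi j X + eta k U *: phi k X
   + g X (phi i U) *: xi i + g X (phi j U) *: xi j + g X (phi k U) *: xi k).
Proof.
move=> [Xi Xj Xk]; apply: metric_inj => W; rewrite (torsion_formula ev) /tau Xi Xj Xk.
rewrite !metricE !xi_metric [g (phi i X) W]metricC [g (phi j X) W]metricC [g (phi k X) W]metricC.
by ring.
Qed.

(** For horizontal [X], [Y] the field [T X Y] is vertical, so only the components of [T U (phi i U)]
    given by [eta_torsion] are needed. *)
Lemma tr_sigma1 X Y : horizontal i j k X -> horizontal i j k Y ->
  frame_tr (fun U => g (T X Y) (T U (phi i U))) =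
  (2 * a * (2 * a * (1 - m%:R) + 4 * d - 12 * a) * g X (phi i Y)) p.
Proof.
move=> hX [Yi Yj Yk]; rewrite (torsion_hor Y hX) Yi Yj Yk.
pose c := 2 * d - 6 * a.
transitivity (
    frame_tr (fun U => (2 * a * g X (phi i Y)) *
      (2 * a * (eta i U * eta i U - g U U) + c * (eta j U * eta j U + eta k U * eta k U)))
  + (frame_tr (fun U => (2 * a * g X (phi j Y)) *
      (2 * a * (eta i U * eta j U - g U (phi k U)) - c * (eta j U * eta i U)))
  + frame_tr (fun U => (2 * a * g X (phi k Y)) *
      (2 * a * (eta i U * eta k U + g U (phi j U)) - c * (eta i U * eta k U))))).
  rewrite -!trD; apply: tr_ext => U; move: (T U (phi i U)) (eta_torsion ev U (phi i U))
    (eta_torsion ev1 U (phi i U)) (eta_torsion ev2 U (phi i U)) => V e1 e2 e3.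
  rewrite !metricE !xi_metric e1 e2 e3 phi2 (phi_phi_prev ev) (phi_phi_next ev2) !metricE !metric_xi.
  by rewrite eta_phi (eta_phi_next ev2) (eta_phi_prev ev) /c; ring.
rewrite !trM !(trM, trD, trN) !(tr_eta _ (eta_scalar _)) tr_g !tr_g_phi !eta_xi.
rewrite !(eta_xi_next ev, eta_xi_next ev1, eta_xi_next ev2).
rewrite !(eta_xi_prev ev, eta_xi_prev ev1, eta_xi_prev ev2).
by rewrite /c !(evE, ev_nat); ring.
Qed.

(** In units of [4 * a * a * g X (phi i Y)], the surviving vertical terms [q j k] and [q k j]
    contribute 2 and the three horizontal ones contribute 1, -1 and -1. *)
Lemma tr_sigma2 X Y : horizontal i j k X -> horizontal i j k Y ->
  frame_tr (fun U => g (T Y U) (T X (phi i U))) = (4 * a * a * g X (phi i Y)) p.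
Proof.
move=> hX hY; have [Xi Xj Xk] := hX; have [Yi Yj Yk] := hY.
pose q l l' := g (phi l Y) (phi l' X).
transitivity (frame_tr (fun U => 4 * a * a * (
    (q i k * (eta i U * eta j U) - q i j * (eta i U * eta k U)
    + (q j k * (eta j U * eta j U) - q j j * (eta j U * eta k U))
    + (q k k * (eta k U * eta j U) - q k j * (eta k U * eta k U)))
  + (- (g U X * g Y (phi i U)) + (g U (phi j Y) * g X (phi k U)
  - g U (phi k Y) * g X (phi j U)))))).
  apply: tr_ext => U.
  rewrite (torsion_hor U hY) (torsion_hor (phi i U) hX).
  rewrite eta_phi (eta_phi_next ev2) (eta_phi_prev ev) phi2 (phi_phi_prev ev) (phi_phi_next ev2).
  rewrite (phi_antisym j Y) (phi_antisym k Y) [g U X]metricC.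
  rewrite !metricE !metric_xi !xi_metric Xi Xj Xk !eta_phi.
  rewrite !(eta_phi_next ev, eta_phi_next ev1, eta_phi_next ev2).
  rewrite !(eta_phi_prev ev, eta_phi_prev ev1, eta_phi_prev ev2).
  rewrite Xi Xj Xk Yi Yj Yk !eta_xi.
  rewrite !(eta_xi_next ev, eta_xi_next ev1, eta_xi_next ev2).
  rewrite !(eta_xi_prev ev, eta_xi_prev ev1, eta_xi_prev ev2).
  by rewrite /q; ring.
rewrite trM !(trM, trD, trN) !(tr_eta _ (eta_scalar _)) !(tr_dual _ (g_phi_scalar _ _)).
rewrite !(eta_xi_next ev, eta_xi_next ev1, eta_xi_next ev2).
rewrite !(eta_xi_prev ev, eta_xi_prev ev1, eta_xi_prev ev2).
rewrite !eta_xi /q !phi_skew (phi_phi_next ev1) (phi_phi_prev ev1) (phi_phi_next ev1).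
rewrite (phi_phi_prev ev1) !(phi_antisym i Y) Xj Xk Yj Yk !scale0r !metricE metric0r.
by rewrite !(evE, ev_nat) (phi_antisym i Y) !evE; ring.
Qed.

Lemma tr_sigma X Y : horizontal i j k X -> horizontal i j k Y ->
  frame_tr (fun U => sigma X Y U (phi i U)) =
  ((2 * a * (2 * a * (1 - m%:R) + 4 * d - 12 * a) + 8 * a * a) * g X (phi i Y)) p.
Proof.
move=> hX hY.
transitivity (frame_tr (fun U => g (T X Y) (T U (phi i U)))
  + (frame_tr (fun U => g (T Y U) (T X (phi i U)))
    - frame_tr (fun U => g (T X U) (T Y (phi i U))))).
  rewrite -trN -!trD; apply: tr_ext => U.
  by rewrite /sigma (torsionC X U) metricNl addrA.
rewrite tr_sigma1// !tr_sigma2// (phi_antisym i Y) !(evE, ev_nat); ring.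
Qed.

Lemma ric_phi n X Y : (m = 4 * n + 3)%N -> horizontal i j k X -> horizontal i j k Y ->
  ric X (phi i Y) - ric Y (phi i X) =
  2 * (4 * alpha * (delta * (n%:R + 2) - 3 * alpha)) * g X (phi i Y) p.
Proof.
move=> mn hX hY; have [Xi Xj Xk] := hX; have [Yi Yj Yk] := hY.
have e0 := tr_sigma hX hY; have e1 := tr_rtens_phi X Y.
have e2 := tr_rtens_phi_mid hX hY; have e3 := tr_rtens_phi_mid hY hX.
have e4 : frame_tr (fun U => sigma X Y U (phi i U)) = frame_tr (fun U => rtens X Y U (phi i U))
   + (frame_tr (fun U => rtens U X Y (phi i U)) - frame_tr (fun U => rtens U Y X (phi i U))).
  rewrite -trN -!trD; apply: tr_ext => U.
  by rewrite -(bianchi_rtens ev) (rtens_skew12 Y U); ring.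
have -> : ric X (phi i Y) =
    (4 * a * b * g X (phi i Y)) p - frame_tr (fun U => rtens U X Y (phi i U)).
  by rewrite e2; ring.
have -> : ric Y (phi i X) =
    (4 * a * b * g Y (phi i X)) p - frame_tr (fun U => rtens U Y X (phi i U)).
  by rewrite e3; ring.
move: e0 e1 e4; rewrite /rotation_form Xj Xk Yj Yk (phi_antisym i Y).
set s := frame_tr (fun U => sigma _ _ _ _).
set t := frame_tr (fun U => rtens X Y U _) => e0 e1 e4.
set t1 := frame_tr (fun U => rtens U X Y _) in e4 *.
set t2 := frame_tr (fun U => rtens U Y X _) in e4 *.
have mR : m%:R = 4 * n%:R + 3 :> R by rewrite mn natrD natrM.
(* The identity is doubled because [tr_rtens_phi] gives twice its trace. *)
apply: (@mulfI _ 2); first by rewrite pnatr_eq0.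
transitivity (2 * (8 * a * b * g X (phi i Y)) p + 2 * t - 2 * s).
  by rewrite e4 /b !(evE, ev_nat); ring.
have mS : m.+1%:R = 4 * n%:R + 4 :> R by rewrite mn -[_.+1]addn1 natrD natrD natrM; ring.
by rewrite e0 e1 mS /b !(evE, ev_nat) mR; ring.
Qed.

End TraceFormulas.

Lemma ric_linl Y f X1 X2 : ric (f *: X1 + X2) Y = f p * ric X1 Y + ric X2 Y.
Proof.
rewrite /ric -trM -trD; apply: tr_ext => U.
rewrite (rtens_skew12 U) (rtens_scalar1 U Y U f X1 X2) (rtens_skew12 X1) (rtens_skew12 X2).
ring.
Qed.

(** * The Ricci tensor on horizontal fields and in general *)

Section RicciHorizontal.
Variables (n : nat) (i j k : 'I_3).
Hypothesis mn : (m = 4 * n + 3)%N.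
Hypothesis ev : even_triple i j k.
Let ev1 := even_triple_rot ev.
Let ev2 := even_triple_rot ev1.
Let lam : R := 4 * alpha * (delta * (n%:R + 2) - 3 * alpha).

Definition ric0 X Y := ric X Y - lam * g X Y p.

Lemma ric0C X Y : ric0 X Y = ric0 Y X.
Proof. by rewrite /ric0 (ricC ev) metricC. Qed.

Lemma ric0Nl X Y : ric0 (- X) Y = - ric0 X Y.
Proof.
have e0 : ric 0 Y = 0.
  have := ric_linl Y 0 0 0; rewrite scaler0 addr0 /= mul0r add0r => e1.
  have := ric_linl Y 1 0 0; rewrite scaler0 addr0 /= mul1r => /eqP.
  by rewrite -subr_eq0 opprD addNKr oppr_eq0 => /eqP.
have := ric_linl Y (-1) X 0; rewrite scaleN1r addr0 e0 addr0 !evE => e1.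
by rewrite /ric0 e1 metricNl evN; ring.
Qed.

(** As [phi l] is skew for [g], subtracting [lam * g] absorbs exactly the right-hand side of
    [ric_phi]. *)
Lemma ric0_phi l l1 l2 X Y : even_triple l l1 l2 ->
  horizontal l l1 l2 X -> horizontal l l1 l2 Y ->
  ric0 X (phi l Y) = ric0 Y (phi l X).
Proof.
move=> evl hX hY; have e1 := ric_phi evl mn hX hY.
apply/eqP; rewrite -subr_eq0; apply/eqP; rewrite /ric0.
transitivity ((ric X (phi l Y) - ric Y (phi l X)) - (2 * lam) * g X (phi l Y) p).
  by rewrite (phi_antisym l Y) evN; ring.
by rewrite e1 /lam; ring.
Qed.

Lemma ric0_phiphi l l1 l2 X Y : even_triple l l1 l2 ->
  horizontal l l1 l2 X -> horizontal l l1 l2 Y ->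
  ric0 (phi l X) (phi l Y) = - ric0 X Y.
Proof.
move=> evl hX hY; rewrite (ric0_phi evl (horizontal_phi evl hX) hY).
by rewrite (horizontal_phi2 hX) ric0C ric0Nl.
Qed.

(* [ric0] changes sign under each [phi l], but [phi k = phi i \o phi j] on
   horizontal vectors. *)
Lemma ric0_horizontal X Y : horizontal i j k X -> horizontal i j k Y -> ric0 X Y = 0.
Proof.
move=> hX hY.
have h1 Z : horizontal i j k Z -> horizontal j k i Z by case.
have h2 Z : horizontal i j k Z -> horizontal k i j Z by case.
have h3 Z : horizontal j k i Z -> horizontal i j k Z by case.
have pk Z : horizontal i j k Z -> phi k Z = phi i (phi j Z).
  by move=> [_ Zj _]; rewrite (phi_phi_next ev) Zj scale0r addr0.
have := ric0_phiphi ev2 (h2 _ hX) (h2 _ hY).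
rewrite !pk// (ric0_phiphi ev) ?(ric0_phiphi ev1); last 4 first.
- exact: h1.
- exact: h1.
- exact: h3 (horizontal_phi ev1 (h1 _ hX)).
- exact: h3 (horizontal_phi ev1 (h1 _ hY)).
by rewrite opprK => /eqP; rewrite -addr_eq0 -mulr2n mulrn_eq0 => /eqP.
Qed.

Lemma ric_formula X Y : ric X Y = lam * g X Y p +
  4 * alpha * (delta * (2 - n%:R) - 5 * alpha) *
    (eta i X p * eta i Y p + eta j X p * eta j Y p + eta k X p * eta k Y p).
Proof.
(* The vertical eigenvalue [8 * a * b] of [ric_xi]; it is also the sum of the two coefficients in
   the statement. *)
pose c : R := 16 * alpha * (delta - 2 * alpha).
have xiE l l1 l2 Z : even_triple l l1 l2 -> ric (xi l) Z = c * eta l Z p.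
  move=> evl; rewrite (ricC ev) (ric_xi evl) /b /c !(evE, ev_nat); ring.
have split Z W : ric Z W = ric (hpart i j k Z) W +
    c * (eta i Z p * eta i W p + eta j Z p * eta j W p + eta k Z p * eta k W p).
  have {1}-> : Z = eta i Z *: xi i + (eta j Z *: xi j + (eta k Z *: xi k + hpart i j k Z)).
    apply: metric_inj => U; rewrite /hpart !metricE; ring.
  by rewrite !ric_linl (xiE _ _ _ _ ev) (xiE _ _ _ _ ev1) (xiE _ _ _ _ ev2); ring.
have hh := ric0_horizontal (hpart_horizontal ev X) (hpart_horizontal ev Y).
have [hXi hXj hXk] := hpart_horizontal ev X.
rewrite split (ricC ev) split hXi hXj hXk (ricC ev).
have -> : ric (hpart i j k X) (hpart i j k Y) = lam * g (hpart i j k X) (hpart i j k Y) p.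
  by apply/eqP; rewrite -subr_eq0 -/(ric0 _ _) hh.
have -> : g (hpart i j k X) (hpart i j k Y) =
    g X Y - (eta i X * eta i Y + eta j X * eta j Y + eta k X * eta k Y).
  rewrite /hpart !metricE !metric_xi !xi_metric !eta_xi.
  rewrite !(eta_xi_next ev, eta_xi_next ev1, eta_xi_next ev2).
  rewrite !(eta_xi_prev ev, eta_xi_prev ev1, eta_xi_prev ev2).
  by ring.
by rewrite /c /lam !evE; ring.
Qed.

End RicciHorizontal.

End Traces.

End Canonical.

End Algebra.

(** * The Ricci formula and its consequences *)

Lemma ricci_formula (R : realType) (n : nat) (M : manifold R (4 * n + 3)%N)
    (phi : 'I_3 -> {linear vfield M -> vfield M}) (xi : 'I_3 -> vfield M)
    (eta : 'I_3 -> {scalar vfield M}) (g : vfield M -> vfield M -> Cinf M)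
    (alpha delta : R) (nabla : vfield M -> vfield M -> vfield M) :
  sasaki_3_alpha_delta phi xi eta g alpha delta ->
  canonical_connection phi eta g alpha delta nabla ->
  forall X Y p, ricci g nabla X Y p =
        4 * alpha * (delta * (n%:R + 2) - 3 * alpha) * g X Y p
        + 4 * alpha * (delta * (2 - n%:R) - 5 * alpha)
          * \sum_(i < 3) eta i X p * eta i Y p.
Proof.
move=> [A3 a0 dE] cN X Y p; have [gR _ _] := A3.
have [i [j [k ev]]] := even_triple_ex.
rewrite (sum_even_triple _ ev) /ricci; set e := xget _ _.
have oe : orthonormal_at g p e.
  by have := xgetPex (fun=> 0) (orthonormal_exists p gR).
exact: (ric_formula gR A3 dE cN a0 oe (erefl _) ev).
Qed.

(** Evaluation at a [xi i] gives [c1 + c2 = 0], the trace gives [(4 * n + 3) * c1 + 3 * c2 = 0]; the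
    system is regular because [n] is positive. *)
Lemma metric_eta_independent (R : realType) (n : nat) (M : manifold R (4 * n + 3)%N)
    (phi : 'I_3 -> {linear vfield M -> vfield M}) (xi : 'I_3 -> vfield M)
    (eta : 'I_3 -> {scalar vfield M}) (g : vfield M -> vfield M -> Cinf M)
    (p : M) (c1 c2 : R) :
  (1 <= n)%N -> almost_3contact_metric phi xi eta g ->
  (forall X, c1 * g X X p + c2 * \sum_(i < 3) eta i X p * eta i X p = 0) ->
  c1 = 0 /\ c2 = 0.
Proof.
move=> n0 A3; have [gR _ _] := A3; have [i [j [k ev]]] := even_triple_ex => h.
have ev1 := even_triple_rot ev; have ev2 := even_triple_rot ev1.
have [e oe] := orthonormal_exists p gR.
have hxi : c1 + c2 = 0.
  have := h (xi i); rewrite (sum_even_triple _ ev) (metric_xi gR A3).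
  rewrite (eta_xi A3) (eta_xi_next A3 ev2) (eta_xi_prev A3 ev) => <-; rewrite !evE; ring.
have htr : c1 * (4 * n%:R + 3) + c2 * 3 = 0.
  have : \sum_l (c1 * g (e l) (e l) p + c2 * \sum_(i < 3) eta i (e l) p * eta i (e l) p) = 0.
    by rewrite big1.
  rewrite big_split /= -!mulr_sumr => <-.
  rewrite -[\sum_i g _ _ _]/(frame_tr p e (fun U => g U U)) (tr_g oe) natrD natrM.
  rewrite exchange_big (eq_bigr (fun=> 1)); last first.
    move=> l _; rewrite -[LHS]/(frame_tr p e (fun U => eta l U * eta l U)).
    by rewrite (tr_eta gR A3 oe l (eta_scalar eta l)) (eta_xi A3).
  by rewrite sumr_const card_ord.
have c20 : c2 * (4 * n%:R) = 0.
  transitivity ((4 * n%:R + 3) * (c1 + c2) - (c1 * (4 * n%:R + 3) + c2 * 3)); first ring.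
  by rewrite hxi htr mulr0 subr0.
have c2z : c2 = 0.
  by move/eqP: c20; rewrite !mulf_eq0 !pnatr_eq0 [n == _]eqn0Ngt n0 !orbF => /eqP.
by move: hxi; rewrite c2z addr0.
Qed.

Theorem theorem4p4p2 (R : realType) (n : nat) (M : manifold R (4 * n + 3)%N)
    (phi : 'I_3 -> {linear vfield M -> vfield M}) (xi : 'I_3 -> vfield M)
    (eta : 'I_3 -> {scalar vfield M}) (g : vfield M -> vfield M -> Cinf M)
    (alpha delta : R) (nabla : vfield M -> vfield M -> vfield M) :
  (1 <= n)%N ->
  sasaki_3_alpha_delta phi xi eta g alpha delta ->
  canonical_connection phi eta g alpha delta nabla ->
  [/\ forall X Y p, ricci g nabla X Y p =
        4 * alpha * (delta * (n%:R + 2) - 3 * alpha) * g X Y p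
        + 4 * alpha * (delta * (2 - n%:R) - 5 * alpha)
          * \sum_(i < 3) eta i X p * eta i Y p,
      forall X Y p, ricci g nabla X Y p =
        4 * alpha * (delta * (n%:R + 2) - 3 * alpha) * Id_H xi g X Y p
        + 16 * alpha * (delta - 2 * alpha) * Id_V xi g X Y p,
      nabla_einstein g nabla <-> delta * (2 - n%:R) = 5 * alpha
    & ~ nabla_ricci_flat g nabla].
Proof.
move=> n1 S cN; have [A3 a0 _] := S; have [gR _ _] := A3.
have ricE := ricci_formula S cN.
have [p0 _] := manifold_nonempty M.
have [i [j [k ev]]] := even_triple_ex.
have ev1 := even_triple_rot ev; have ev2 := even_triple_rot ev1.
have muz : 4 * alpha * (delta * (2 - n%:R) - 5 * alpha) = 0 -> delta * (2 - n%:R) = 5 * alpha.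
  by move/eqP; rewrite !mulf_eq0 pnatr_eq0 (negPf a0) /= subr_eq0 => /eqP.
split=> //.
- move=> X Y p; rewrite ricE (sum_even_triple _ ev).
  have VE Z : proj_V xi g Z = eta i Z *: xi i + eta j Z *: xi j + eta k Z *: xi k.
    by rewrite /proj_V (sum_even_triple _ ev) !(metric_xi gR A3).
  have IV : Id_V xi g X Y = eta i X * eta i Y + eta j X * eta j Y + eta k X * eta k Y.
    rewrite /Id_V !VE !(metricE gR) !(metric_xi gR A3) !(eta_xi A3).
    rewrite !(eta_xi_next A3 ev, eta_xi_prev A3 ev, eta_xi_next A3 ev1, eta_xi_prev A3 ev1,
      eta_xi_next A3 ev2, eta_xi_prev A3 ev2).
    by ring.
  have IH : Id_H xi g X Y = g X Y - Id_V xi g X Y.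
    rewrite IV /Id_H /proj_H !VE !(metricE gR) !(metric_xi gR A3) !(xi_metric gR A3) !(eta_xi A3).
    rewrite !(eta_xi_next A3 ev, eta_xi_prev A3 ev, eta_xi_next A3 ev1, eta_xi_prev A3 ev1,
      eta_xi_next A3 ev2, eta_xi_prev A3 ev2).
    by ring.
  by rewrite IH IV !evE; ring.
- split=> [[L LE]|mu0].
    apply: muz; pose lam : R := 4 * alpha * (delta * (n%:R + 2) - 3 * alpha).
    (* The factor [L] may vary with the point; its value at [p0], tested on [X = Y], already forces
       the vertical coefficient to vanish. *)
    apply: (proj2 (@metric_eta_independent _ _ _ phi xi eta g p0 (lam - L p0) _ n1 A3 _)).
    move=> X; have := LE X X p0; rewrite ricE => e.
    by rewrite mulrBl -e /lam; field.
  exists (4 * alpha * (delta * (n%:R + 2) - 3 * alpha))%:A => X Y p.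
  by rewrite !ricE mu0 subrr mulr0 !mul0r !addr0 (metricC gR Y X) evE mulr1; field.
- move=> flat; have [|lam0 /muz mu0] := @metric_eta_independent _ _ _ phi xi eta g p0
    (4 * alpha * (delta * (n%:R + 2) - 3 * alpha))
    (4 * alpha * (delta * (2 - n%:R) - 5 * alpha)) n1 A3.
    by move=> X; rewrite -ricE flat.
  have {}lam0 : delta * (n%:R + 2) = 3 * alpha.
    by move/eqP: lam0; rewrite !mulf_eq0 pnatr_eq0 (negPf a0) /= subr_eq0 => /eqP.
  (* Adding the two vanishing conditions eliminates [n]; substituting back leaves
     [alpha * (2 * n + 1) = 0], which is impossible. *)
  have d2 : delta = 2 * alpha.
    apply: (@mulfI _ 4); first by rewrite pnatr_eq0.
    have -> : 4 * delta = delta * (n%:R + 2) + delta * (2 - n%:R) by ring.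
    by rewrite lam0 mu0; ring.
  have : alpha * (2 * n%:R + 1) = 0.
    have -> : alpha * (2 * n%:R + 1) = delta * (n%:R + 2) - 3 * alpha by rewrite d2; ring.
    by rewrite lam0 subrr.
  by move/eqP; rewrite mulf_eq0 (negPf a0) /= -natrM natr1 pnatr_eq0.
Qed.
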